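(* Let $q$ be a prime power, let $f(x)=\sum_{j=1}^{d+2}u_j\prod_{i=1}^dx_i^{m_{ij}}$ with $u_j\in\mathbb{F}_q^\times$ be a Laurent polynomial with distinct exponent vectors, $d$-dimensional Newton polytope $\Delta$, and Gale dual $\gamma\in\mathbb{Z}^{d+2}$ having no zero component; let $r$ (respectively $s$) be the number of negative (respectively positive) components of $\gamma$. Let $Z\subset\mathbb{G}_m^d$ be the hypersurface $f=0$ over $\mathbb{F}_q$ and $\overline{Z}$ its closure in the toric variety $\mathbb{P}_\Delta$. Suppose that $q$ is coprime to $\gamma_1\cdots\gamma_{d+2}$, $r=2$ and $s=3$ (so $d=3$). Then $$\#\overline{Z}(\mathbb{F}_q)=q^2+3q+1-\sum_{\lambda\in\Lambda(q)}\chi^{\lambda}(\sigma)\,q^{s_{\delta(\lambda)}(0)-1}\,g(\delta(\lambda))\,F_q\!\left(\gamma,\delta(\lambda),q^\times\,\Big|\,\frac{t}{\gamma^\gamma}\right).$$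
   Context: Characters. Put $q^\times=q-1$. Fix a non-trivial additive character $\psi:\mathbb{F}_q\to\mathbb{C}^\times$ and a multiplicative character $\chi:\mathbb{F}_q^\times\to\mathbb{C}^\times$ of order $q^\times$; $\chi^m(x)=\chi(x)^m$, $\zeta_k=e^{2\pi i/k}$. The Gauss sum is $g(m)=\sum_{u\in\mathbb{F}_q^\times}\psi(u)\chi^m(u)$ (it depends only on $m$ mod $q^\times$), and $g(v)=\prod_ig(v_i)$ for a vector $v$. Data attached to $f$. Let $m_i=(m_{i1},\dots,m_{i,d+2})\in\mathbb{Z}^{d+2}$ for $i=1,\dots,d$ and $\mathbf{1}=(1,\dots,1)\in\mathbb{Z}^{d+2}$. The Gale dual $\gamma\in\mathbb{Z}^{d+2}$ is the vector, unique up to sign, with $\sum_j\gamma_j=0$, $\sum_jm_{ij}\gamma_j=0$ for all $i$, and $\gcd(\gamma_1,\dots,\gamma_{d+2})=1$ (fix a choice of sign). Let $K=\{x\in\mathbb{Z}^{d+2}:\sum_j\gamma_jx_j=0\}$ and choose a $\mathbb{Z}$-basis $f_0=\mathbf{1},f_1,\dots,f_d$ of $K$; write $m_i=\sum_{l=1}^dc_{il}f_l+r_i\mathbf{1}$. Let $H=A\,(c_{il})$ with $A\in GL_d(\mathbb{Z})$ be the (upper triangular) Hermite normal form of $(c_{il})$ and put $\mathcal{N}=H^{T}$. Choose $\rho_1,\dots,\rho_d\in\mathbb{Z}^{d+2}$ with $\sum_j\rho_{kj}=0$ and $\sum_j\rho_{kj}f_{ij}=1$ if $i=k$, $=0$ if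 $i\ne k$ ($1\le i,k\le d$). (Then $Z$ is isomorphic to the variety in $\mathbb{P}^{d+1}\times\mathbb{G}_m^d$ given by $\sum_jw_j=0$, $\prod_jw_j\ne0$, $\prod_jw_j^{\gamma_j}=t$, $\prod_jw_j^{\rho_{kj}}=\sigma_k\prod_iz_i^{\mathcal{N}_{ki}}$ for $k=1,\dots,d$, with $t,\sigma_k$ as follows.) Set $t=\prod_ju_j^{\gamma_j}$, $\sigma_k=\prod_ju_j^{\rho_{kj}}\in\mathbb{F}_q^\times$, $$\Lambda(q)=\Big\{\lambda\in(\mathbb{Z}/q^\times\mathbb{Z})^d:\ \sum_{k=1}^d\lambda_k\mathcal{N}_{ki}=0\text{ for }i=1,\dots,d\Big\},$$ and for $\lambda\in\Lambda(q)$ set $\delta(j,\lambda)=\sum_{k=1}^d\lambda_k\rho_{kj}\in\mathbb{Z}/q^\times\mathbb{Z}$, $\delta(\lambda)=(\delta(1,\lambda),\dots,\delta(d+2,\lambda))$, and $\chi^{\lambda}(\sigma)=\prod_{k=1}^d\chi^{\lambda_k}(\sigma_k)$. Finite hypergeometric sums. For $\delta\in(\mathbb{Z}/q^\times\mathbb{Z})^{d+2}$ let $D_\delta(T)$ be the greatest common divisor in $\mathbb{C}[T]$ of $\prod_{\gamma_j<0}(T^{-\gamma_j}-\zeta_{q^\times}^{\delta_j})$ and $\prod_{\gamma_j>0}(T^{\gamma_j}-\zeta_{q^\times}^{-\delta_j})$, and let $s_\delta(m)$ be the multiplicity of $e^{2\pi im/q^\times}$ as a zero of $D_\delta(T)$.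 For $q$ coprime to $\gamma_1\cdots\gamma_{d+2}$ and $y\in\mathbb{F}_q^\times$, $$F_q(\gamma,\delta,q^\times\mid y)=\frac{1}{1-q}\sum_{m=0}^{q-2}\frac{g(-\gamma m+\delta)}{g(\delta)}\,q^{s_\delta(-m)-s_\delta(0)}\,\chi^m(\gamma^\gamma y),\qquad\gamma^\gamma=\prod_j\gamma_j^{\gamma_j}.$$ $\mathbb{P}_\Delta$ is the projective toric variety over $\mathbb{F}_q$ associated with the normal fan of $\Delta$; it contains $\mathbb{G}_m^d=\operatorname{Spec}\mathbb{F}_q[x_1^{\pm1},\dots,x_d^{\pm1}]$ as its dense torus.
   Formalization: The factor χ^λ(σ) is replaced by its inverse χ^{-λ}(σ): with the stated conventions the printed formula fails in general when Λ(q) has elements of order greater than 2 (e.g. q=7, γ=(-1,-2,1,1,1)); the two formulas agree when Λ(q) is 2-torsion. *)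

(* Defs.v *)
From HB Require Import structures.
From mathcomp Require Import all_boot all_order all_algebra.
From mathcomp Require Import all_classical all_reals all_analysis.
From mathcomp Require Import complex.

Set Implicit Arguments.
Unset Strict Implicit.
Unset Printing Implicit Defensive.

Import Order.TTheory GRing.Theory Num.Theory.

Local Open Scope classical_set_scope.
Local Open Scope ring_scope.

(** * Characters of a finite field, with values in the complex numbers [R[i]] *)

Definition nontrivial_additive_character (R : realType) (F : finFieldType)
    (psi : F -> R[i]) : Prop :=
  [/\ forall x, psi x != 0,
      forall x y, psi (x + y) = psi x * psi y
    & exists x, psi x != 1].

(* A character of F^* is represented by a function on F whose value at 0 is
   irrelevant. *)
Definition multiplicative_character (R : realType) (F : finFieldType)
    (chi : F -> R[i]) : Prop :=
  (forall x, x != 0 -> chi x != 0) /\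
  (forall x y, x != 0 -> y != 0 -> chi (x * y) = chi x * chi y).

Definition character_order (R : realType) (F : finFieldType)
    (chi : F -> R[i]) (n : nat) : Prop :=
  [/\ (0 < n)%N,
      forall x, x != 0 -> chi x ^+ n = 1
    & forall k, (0 < k < n)%N -> exists2 x, x != 0 & chi x ^+ k != 1].

Definition gauss_sum (R : realType) (F : finFieldType) (psi chi : F -> R[i])
    (v : int) : R[i] :=
  \sum_(x : F | x != 0) psi x * chi x ^ v.

Definition gauss_prod (R : realType) (F : finFieldType) (psi chi : F -> R[i])
    (n : nat) (v : 'I_n -> int) : R[i] :=
  \prod_j gauss_sum psi chi (v j).

(** * Finite hypergeometric sums

   Elements of Z/(q-1) are given by integer representatives; everything below
   depends on them modulo q-1 only, since [chi] and [zeta (q-1)] have order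
   q-1. *)

Definition zeta (R : realType) (k : nat) : R[i] :=
  Complex (cos (2 * pi / k%:R)) (sin (2 * pi / k%:R)).

Definition D_poly (R : realType) (k n : nat) (gamma delta : 'I_n -> int) :
    {poly R[i]} :=
  gcdp (\prod_(j | gamma j < 0)
          ('X^`|gamma j|%N - (zeta R k ^ delta j)%:P))
       (\prod_(j | 0 < gamma j)
          ('X^`|gamma j|%N - (zeta R k ^ (- delta j))%:P)).

Definition s_mult (R : realType) (k n : nat) (gamma delta : 'I_n -> int)
    (m : int) : nat :=
  mup (zeta R k ^ m) (D_poly R k gamma delta).

Definition gamma_gamma (F : finFieldType) (n : nat) (gamma : 'I_n -> int) : F :=
  \prod_j (gamma j)%:~R ^ gamma j.

Definition hypergeometric_sum (R : realType) (F : finFieldType)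
    (psi chi : F -> R[i]) (n : nat) (gamma delta : 'I_n -> int) (y : F) :
    R[i] :=
  let k := #|F|.-1 in
  (1 - #|F|%:R)^-1 *
  \sum_(0 <= m < k)
     gauss_prod psi chi (fun j => - gamma j * m%:Z + delta j)
       / gauss_prod psi chi delta
     * #|F|%:R ^ ((s_mult R k gamma delta (- m%:Z))%:Z
                  - (s_mult R k gamma delta 0)%:Z)
     * chi (gamma_gamma F gamma * y) ^+ m.

(** * Lattice data attached to the exponents

   The exponent vectors are the columns of [m]. *)

(* The affine hull of the Newton polytope is that of the exponents, so its
   dimension is the rank of their differences. *)
Definition newton_dim (d : nat) (m : 'M[int]_(d, d.+2)) : nat :=
  \rank (\matrix_(i < d, j < d.+2) ((m i j - m i ord0)%:~R : rat)).

Definition gale_dual (d : nat) (m : 'M[int]_(d, d.+2))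
    (gamma : 'I_d.+2 -> int) : Prop :=
  [/\ \sum_j gamma j = 0,
      forall i, \sum_j m i j * gamma j = 0
    & \big[gcdn/0%N]_j `|gamma j|%N = 1%N].

(* 1 and the rows of [f] form a Z-basis of the orthogonal of [gamma]. *)
Definition kernel_basis (d : nat) (gamma : 'I_d.+2 -> int)
    (f : 'M[int]_(d, d.+2)) : Prop :=
  (forall l, \sum_j gamma j * f l j = 0) /\
  (forall x : 'rV[int]_d.+2, \sum_j gamma j * x 0 j = 0 ->
     exists! c : 'rV[int]_(1 + d), x = c *m col_mx (const_mx 1) f).

(* Row-style Hermite normal form of a nonsingular square matrix. *)
Definition hermite_normal (d : nat) (H : 'M[int]_d) : Prop :=
  [/\ forall i j : 'I_d, (j < i)%N -> H i j = 0,
      forall i : 'I_d, 0 < H i i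
    & forall i j : 'I_d, (i < j)%N -> 0 <= H i j < H j j].

Definition rho_system (d : nat) (f rho : 'M[int]_(d, d.+2)) : Prop :=
  (forall k, \sum_j rho k j = 0) /\
  (forall i k, \sum_j rho k j * f i j = (i == k)%:Z).

Definition t_param (F : finFieldType) (n : nat) (gamma : 'I_n -> int)
    (u : 'I_n -> F) : F :=
  \prod_j u j ^ gamma j.

Definition sigma_param (F : finFieldType) (d n : nat) (rho : 'M[int]_(d, n))
    (u : 'I_n -> F) (k : 'I_d) : F :=
  \prod_j u j ^ rho k j.

(* Lambda(q) for q - 1 = [Q], its elements being given by their
   representatives in [0, Q[. *)
Definition Lambda (Q d : nat) (N : 'M[int]_d) : {set {ffun 'I_d -> 'I_Q}} :=
  [set lam : {ffun 'I_d -> 'I_Q} |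
    [forall i, (Q%:Z %| \sum_k (lam k)%:Z * N k i)%Z]]%SET.

Definition delta_of (Q d n : nat) (rho : 'M[int]_(d, n))
    (lam : {ffun 'I_d -> 'I_Q}) (j : 'I_n) : int :=
  \sum_k (lam k)%:Z * rho k j.

(* chi^lam(sigma). Expanding the point count in Gauss sums pairs
   g(- gamma m + delta(lam)) with chi^m(t) and the inverse of chi^lam(sigma). *)
Definition character_pow (R : realType) (F : finFieldType) (chi : F -> R[i])
    (Q d : nat) (lam : {ffun 'I_d -> 'I_Q}) (sigma : 'I_d -> F) : R[i] :=
  \prod_k chi (sigma k) ^+ lam k.

(** * The toric variety of the normal fan of the Newton polytope

   M = 'cV[int]_d is the character lattice and 'cV[R]_d plays the role both of
   M_R and of its dual N_R. *)

Definition dot (R : realType) (d : nat) (x n : 'cV[R]_d) : R :=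
  \sum_i x i 0 * n i 0.

Definition newton_polytope (R : realType) (d p : nat) (m : 'M[int]_(d, p)) :
    set 'cV[R]_d :=
  [set x | exists a : 'I_p -> R,
     [/\ forall j, 0 <= a j, \sum_j a j = 1
       & x = \sum_j a j *: map_mx intr (col j m)]].
Arguments newton_polytope : clear implicits.
Arguments newton_polytope R {d p} m.

Definition face (R : realType) (d : nat) (P : set 'cV[R]_d) (n : 'cV[R]_d) :
    set 'cV[R]_d :=
  [set x | P x /\ forall y, P y -> dot x n <= dot y n].

Definition normal_cone (R : realType) (d : nat) (P Q : set 'cV[R]_d) :
    set 'cV[R]_d :=
  [set n | Q `<=` face P n].

(* Inner normals; every nonempty face of a polytope is of the form [face P n]. *)
Definition normal_fan (R : realType) (d : nat) (P : set 'cV[R]_d) :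
    set (set 'cV[R]_d) :=
  [set sigma | exists n, sigma = normal_cone P (face P n)].

Definition dual_monoid (R : realType) (d : nat) (sigma : set 'cV[R]_d) :
    set 'cV[int]_d :=
  [set a | forall n, sigma n -> 0 <= dot (map_mx intr a) n].

(* The F-points of U_sigma = Spec F[dual_monoid sigma]: monoid morphisms from
   [dual_monoid sigma] to the multiplicative monoid of F, extended by 0 outside [dual_monoid sigma]. *)
Definition chart_points (R : realType) (F : fieldType) (d : nat)
    (sigma : set 'cV[R]_d) : set ('cV[int]_d -> F) :=
  [set phi | [/\ phi 0 = 1,
      forall a b, dual_monoid sigma a -> dual_monoid sigma b ->
        phi (a + b) = phi a * phi b
    & forall a, ~ dual_monoid sigma a -> phi a = 0]].

Definition local_points (R : realType) (F : fieldType) (d : nat)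
    (P : set 'cV[R]_d) : set (set 'cV[R]_d * ('cV[int]_d -> F)) :=
  [set x | normal_fan P x.1 /\ chart_points x.1 x.2].

(* U_sigma and U_tau are glued along U_(sigma `&` tau). *)
Definition glued (R : realType) (F : fieldType) (d : nat)
    (x y : set 'cV[R]_d * ('cV[int]_d -> F)) : Prop :=
  exists theta, [/\ chart_points (x.1 `&` y.1) theta,
      forall a, dual_monoid x.1 a -> theta a = x.2 a
    & forall a, dual_monoid y.1 a -> theta a = y.2 a].

(* F-points of the toric variety, as classes of points of the charts. *)
Definition toric_points (R : realType) (F : fieldType) (d : nat)
    (P : set 'cV[R]_d) : set (set (set 'cV[R]_d * ('cV[int]_d -> F))) :=
  [set C | exists2 x, local_points P x
         & C = [set y | local_points P y /\ glued x y]].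

(* Laurent polynomials over F are the finitely supported functions on M. *)
Definition laurent_mul (F : fieldType) (d : nat) (g h : 'cV[int]_d -> F) :
    'cV[int]_d -> F :=
  fun a => \sum_(b \in [set: 'cV[int]_d]) g b * h (a - b).

Definition laurent_of (F : fieldType) (d p : nat) (m : 'M[int]_(d, p))
    (u : 'I_p -> F) : 'cV[int]_d -> F :=
  fun a => \sum_(j | col j m == a) u j.

(* Whether a point of U_sigma lies on the Zariski closure in U_sigma of the
   subscheme g = 0 of the torus, i.e. on the zero locus of the ideal
   (g) `&` F[dual_monoid sigma]. This is the closure of the variety, not of
   its set of F-points. *)
Definition on_closure (R : realType) (F : fieldType) (d : nat)
    (g : 'cV[int]_d -> F) (x : set 'cV[R]_d * ('cV[int]_d -> F)) : Prop :=
  forall h : 'cV[int]_d -> F,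
    finite_set [set a | h a != 0] ->
    (forall a, laurent_mul g h a != 0 -> dual_monoid x.1 a) ->
    \sum_(a \in [set: 'cV[int]_d]) laurent_mul g h a * x.2 a = 0.

Definition closure_points (R : realType) (F : fieldType) (d : nat)
    (P : set 'cV[R]_d) (g : 'cV[int]_d -> F) :
    set (set (set 'cV[R]_d * ('cV[int]_d -> F))) :=
  [set C | toric_points P C /\ exists2 x, C x & on_closure g x].

(* Main.v *)
Require Import Defs.
From HB Require Import structures.
From mathcomp Require Import all_boot all_order all_algebra cyclic finfield.
From mathcomp Require Import all_classical all_reals all_analysis.
From mathcomp Require Import complex.
From mathcomp Require Import zify ring lra.
Import Order.TTheory GRing.Theory Num.Theory.
Local Open Scope classical_set_scope.
Local Open Scope ring_scope.

Set Implicit Arguments.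
Unset Strict Implicit.
Unset Printing Implicit Defensive.

(** Let [Q = q - 1]. The rational points of the toric variety split into torus
    orbits, one for each face of the Newton polytope, and the closure of the
    hypersurface meets the orbit of a face in the zero locus of the truncation
    of [f] to that face ([closure_pointsE]). So the count is a sum over faces of
    numbers of points of hypersurfaces in tori.

    Such a number has a classical expansion in Gauss sums ([torus_count]):
    detect zeros with the additive character, and expand the values of the
    additive character in multiplicative ones. The result is a sum over the
    vectors [v] modulo [Q] that are relations between the exponents of the
    truncation ([relations]), weighted by products of Gauss sums
    ([gauss_term]). The lattice of a face is saturated, hence a direct factor
    ([span_lattice_basis]), so these are just the relations between all the
    exponents that are supported on the face ([relations_face]). By Gale
    duality they are the vectors [gamma t - delta lam] with [t] modulo [Q] and
    [lam] in [Lambda] ([sum_relations]), which is the index set of the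
    hypergeometric sums.

    It remains to compare coefficients. The subsets spanning proper faces are
    the non-empty ones whose complement meets both the negative and the positive
    indices ([is_face]). As [g 0 = -1], passing from the whole polytope to a
    face [I] changes the term of [v] by the sign [(-1)^(5 - |I|)], and by
    inclusion and exclusion the proper faces add the term of [v], for [v] not 0,
    once if [v] vanishes at some negative and at some positive index, and not
    otherwise ([sum_sign_faces]). On the other side the exponent of [q] in the
    hypergeometric sum is the minimum of the numbers of negative and of positive
    indices where [v] vanishes ([s_multE]). This is at most 1 when [v] is not 0,
    since there are two negative and three positive indices ([zero_mult_le1]),
    and then both coefficients are equal, as [q / Q = 1 / Q + 1]. The term
    [v = 0] and the numbers of points of the orbits give the polynomial in [q]
    ([face_sum]).

    Gale duality also replaces convex geometry in the description of the fan:
    the facets are the complements of the pairs of a positive index [p] and a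
    negative index [k], and [wall p k] is the corresponding integral linear
    form. The monoids and lattices of exponents below are defined by signs of
    walls, and [dual_monoid_cone] relates them to the cones of the normal fan. *)

(** * Characters and Gauss sums *)

Section CharacterSums.
Variables (R : realType) (F : finFieldType) (psi chi : F -> R[i]).
Hypothesis psiP : nontrivial_additive_character psi.
Hypothesis chiP : multiplicative_character chi.
Hypothesis chi_order : character_order chi #|F|.-1.
Local Notation q := #|F|.
Local Notation Q := #|F|.-1.
Local Notation g := (gauss_sum psi chi).

Lemma card_F_gt1 : (1 < q)%N.
Proof. by rewrite (cardD1 0) (cardD1 1) !inE oner_neq0. Qed.

Lemma Q_gt0 : (0 < Q)%N. Proof. by have := card_F_gt1; lia. Qed.

Lemma card_F : q = Q.+1. Proof. by have := card_F_gt1; lia. Qed.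

Lemma psi0 : psi 0 = 1.
Proof.
have [nz mul _] := psiP; have := mul 0 0; rewrite addr0 => e.
by apply: (mulfI (nz 0)); rewrite mulr1 -e.
Qed.

Lemma sum_psi y : \sum_x psi (y * x) = if y == 0 then q%:R else 0.
Proof.
case: eqVneq => [->|y0].
  under eq_bigr do rewrite mul0r psi0.
  by rewrite sumr_const.
have [_ mul [a pa]] := psiP.
pose S := \sum_x psi (y * x).
have : S = psi a * S.
  rewrite mulr_sumr /S (reindex_inj (addrI (a / y))) /=.
  apply: eq_bigr => x _; rewrite mulrDr mul; congr (psi _ * _).
  by rewrite mulrCA mulfV ?mulr1.
move/eqP; rewrite -subr_eq0 -{1}[S]mul1r -mulrBl mulf_eq0 subr_eq0 eq_sym.
by rewrite (negbTE pa) => /eqP.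
Qed.

Lemma chi_nz x : x != 0 -> chi x != 0. Proof. exact: chiP.1. Qed.

Lemma chiM x y : x != 0 -> y != 0 -> chi (x * y) = chi x * chi y.
Proof. exact: chiP.2. Qed.

Lemma chi1 : chi 1 = 1.
Proof.
have := chiM (oner_neq0 _) (oner_neq0 _); rewrite mulr1 => e.
by apply: (mulfI (chi_nz (oner_neq0 _))); rewrite mulr1 -e.
Qed.

Lemma chi_expQ x : x != 0 -> chi x ^+ Q = 1.
Proof. by case: chi_order => _ + _; apply. Qed.

Lemma chiX x (n : int) : x != 0 -> chi (x ^ n) = chi x ^ n.
Proof.
move=> x0; have nat n' : chi (x ^+ n') = chi x ^+ n'.
  by elim: n' => [|n' IH]; rewrite ?expr0 ?chi1 // !exprS chiM ?expf_neq0 ?IH.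
have inv y : y != 0 -> chi y^-1 = (chi y)^-1.
  move=> y0; apply: (mulfI (chi_nz y0)); rewrite -chiM ?invr_eq0 //.
  by rewrite !mulfV ?chi_nz // chi1.
by case: n => n /=; rewrite ?NegzE -?exprnN ?inv ?expf_neq0 ?nat.
Qed.

Lemma chi_prod (I : finType) (P : pred I) (h : I -> F) :
  (forall i, h i != 0) -> chi (\prod_(i | P i) h i) = \prod_(i | P i) chi (h i).
Proof.
move=> h0.
have [] : \prod_(i | P i) h i != 0 /\
          chi (\prod_(i | P i) h i) = \prod_(i | P i) chi (h i); last by [].
apply: (big_rec2 (fun x y => x != 0 /\ chi x = y)).
  by rewrite oner_neq0 chi1.
move=> i y1 y2 Pi [y10 <-]; split; first by rewrite mulf_neq0.
by rewrite chiM.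
Qed.

Lemma chi_exp_mod x (a b : int) :
  x != 0 -> (Q%:Z %| a - b)%Z -> chi x ^ a = chi x ^ b.
Proof.
move=> x0 /dvdzP[c ec]; have -> : a = b + Q%:Z * c by rewrite mulrC -ec; ring.
rewrite expfzDr ?chi_nz // -exprz_exp -[chi x ^ (Q%:Z)]/(chi x ^+ Q) chi_expQ //.
by rewrite exp1rz mulr1.
Qed.

Lemma sum_chi (e : int) :
  \sum_(x | x != 0) chi x ^ e = if (Q%:Z %| e)%Z then Q%:R else 0.
Proof.
case: ifP => dvd.
  rewrite (eq_bigr (fun=> 1)) => [|x x0]; last first.
    by rewrite (@chi_exp_mod x e 0) ?subr0.
  rewrite sumr_const; congr _%:R.
  rewrite -cardsE (_ : [set _ | _]%SET = [set~ 0]%SET) ?cardsC1 //.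
  by apply/setP => x; rewrite !inE.
have Qn0 : (Q%:Z != 0) by have := Q_gt0; lia.
have k_ge0 := modz_ge0 e Qn0.
have [a a0 na] : exists2 a, a != 0 & chi a ^ e != 1.
  have [k ek] : exists k : nat, (e %% Q)%Z = k by exists `|(e %% Q)%Z|%N; lia.
  have [_ _ /(_ k)[]] := chi_order.
    rewrite -[(k < Q)%N]ltz_nat -ek ltz_pmod ?andbT; last by have := Q_gt0; lia.
    rewrite lt0n; apply: contraFN dvd => /eqP k0.
    by apply/dvdz_mod0P; rewrite ek k0.
  move=> a a0 na; exists a => //.
  rewrite (@chi_exp_mod a e k%:Z) // -ek {1}(divz_eq e Q).
  by rewrite addrK dvdz_mull.
pose S := \sum_(x | x != 0) chi x ^ e.
have : S = chi a ^ e * S.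
  rewrite mulr_sumr /S (reindex_inj (mulfI a0)) /=.
  apply: eq_big => [x|x]; first by rewrite mulf_eq0 (negbTE a0).
  by rewrite mulf_eq0 (negbTE a0) /= => x0; rewrite chiM // expfzMl.
move/eqP; rewrite -subr_eq0 -{1}[S]mul1r -mulrBl mulf_eq0 subr_eq0 eq_sym.
by rewrite (negbTE na) => /eqP.
Qed.

(** The order of [chi] is that of the cyclic group of non-zero elements, so a
    generator has a value of exact order [q - 1]. *)
Lemma chi_inj1 x : x != 0 -> chi x = 1 -> x = 1.
Proof.
move=> x0 cx.
have unity (y : F) : y != 0 -> y ^+ Q = 1.
  move=> y0; have := expf_card y; rewrite {1}card_F exprS => e.
  by apply: (mulfI y0); rewrite e mulr1.
have /hasP[z _ zP] : has Q.-primitive_root [seq y <- enum F | y != 0].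
  apply: has_prim_root; rewrite ?Q_gt0 //.
  - by apply/allP => y; rewrite mem_filter => /andP[/unity/eqP y1 _]; rewrite unity_rootE.
  - by rewrite filter_uniq ?enum_uniq.
  - rewrite -(@cardsC1 F 0) cardE enumT eq_leq //; congr size.
    by apply: eq_filter => y; rewrite !inE.
have z0 : z != 0.
  apply: contra_eq_neq (prim_expr_order zP) => ->.
  by rewrite expr0n gtn_eqF ?Q_gt0 // eq_sym oner_eq0.
have [i ei] := prim_rootP zP (unity _ x0).
case: (posnP i) => [i0|i0]; first by rewrite ei i0.
have [_ _ /(_ i)[]] := chi_order; first by rewrite i0 ltn_ord.
move=> y y0; have [j ->] := prim_rootP zP (unity _ y0).
have pw n : chi (z ^+ n) = chi z ^+ n by exact: (chiX n z0).
by rewrite pw -exprM mulnC exprM -pw -ei cx expr1n eqxx.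
Qed.

Lemma sum_chi_exp x : x != 0 ->
  \sum_(m < Q) chi x ^+ m = if x == 1 then Q%:R else 0.
Proof.
move=> x0; case: eqVneq => [->|x1].
  by under eq_bigr do rewrite chi1 expr1n; rewrite sumr_const card_ord.
apply/eqP; have := subrX1 (chi x) Q; rewrite chi_expQ // subrr => /esym/eqP.
rewrite mulf_eq0 subr_eq0 => /orP[/eqP/(chi_inj1 x0)/eqP|//].
by rewrite (negbTE x1).
Qed.

Lemma gauss_sum_mod (a b : int) : (Q%:Z %| a - b)%Z -> g a = g b.
Proof.
by move=> dvd; apply: eq_bigr => x x0; rewrite (@chi_exp_mod x a b).
Qed.

Lemma Q_neq0 : Q%:R != 0 :> R[i].
Proof. by rewrite pnatr_eq0 -lt0n Q_gt0. Qed.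

(** Fourier inversion on the multiplicative group. *)
Lemma psi_gauss (a : F) : a != 0 ->
  psi a = Q%:R^-1 * \sum_(m < Q) g (- (m : nat)%:Z) * chi a ^+ m.
Proof.
move=> a0.
have -> : \sum_(m < Q) g (- (m : nat)%:Z) * chi a ^+ m =
    \sum_(x | x != 0) psi x * \sum_(m < Q) chi (a / x) ^+ m.
  under eq_bigr do rewrite mulr_suml.
  rewrite exchange_big; apply: eq_bigr => x x0; rewrite mulr_sumr.
  apply: eq_bigr => m _; rewrite -mulrA; congr (_ * _).
  rewrite chiM ?invr_eq0 // exprMn (chiX (-1) x0) -[_ ^+ m in RHS]exprnP mulrC.
  by congr (_ * _); rewrite exprnP exprz_exp mulN1r.
rewrite (bigD1 a) //= [X in _ + X]big1 => [|x /andP[x0 xa]].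
  by rewrite addr0 mulfV // sum_chi_exp ?oner_neq0 // eqxx mulrCA mulVf ?mulr1 ?Q_neq0.
rewrite sum_chi_exp ?mulf_neq0 ?invr_eq0 // ifF ?mulr0 //.
apply: contraNF xa => /eqP e; apply/eqP.
by rewrite -[a](divfK x0) e mul1r.
Qed.

Lemma gauss_sum0 : g 0 = -1.
Proof.
have := sum_psi 1; rewrite oner_eq0 (bigD1 0) //= mulr0 psi0 => /eqP.
rewrite addrC addr_eq0 => /eqP <-.
by apply: eq_bigr => x _; rewrite mul1r expr0z mulr1.
Qed.

(** A non-trivial Gauss sum times its complex conjugate is [q]; the conjugate
    enters as the sum of [psi (- y)] times the inverse character. *)
Lemma gauss_sum_neq0 (v : int) : g v != 0.
Proof.
case: (boolP (Q%:Z %| v)%Z) => dv.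
  rewrite (@gauss_sum_mod v 0) ?subr0 // gauss_sum0 oppr_eq0.
  exact: oner_neq0.
suff : g v * (\sum_(y | y != 0) psi (- y) * chi y ^ (- v)) = q%:R.
  apply: contra_eq_neq => ->; rewrite mul0r eq_sym pnatr_eq0.
  by rewrite card_F.
rewrite mulr_sumr.
transitivity (\sum_(y | y != 0) \sum_(z | z != 0) psi ((z - 1) * y) * chi z ^ v).
  apply: eq_bigr => y y0; rewrite mulr_suml (reindex_inj (mulIf y0)) /=.
  apply: eq_big => [x|x]; first by rewrite mulf_eq0 (negbTE y0) orbF.
  rewrite mulf_eq0 (negbTE y0) orbF => x0.
  have [_ mul _] := psiP.
  rewrite mulrACA -mul -{2}[y]mul1r -mulrBl; congr (_ * _).
  rewrite chiM // expfzMl.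
  by rewrite -mulrA -expfzDr ?chi_nz // subrr expr0z mulr1.
rewrite exchange_big /=.
have inner z : \sum_(y | y != 0) psi ((z - 1) * y) = (if z == 1 then q%:R else 0) - 1.
  have := sum_psi (z - 1); rewrite subr_eq0 => <-.
  by rewrite [X in _ = X - _](bigD1 0) //= mulr0 psi0 addrAC subrr add0r.
under eq_bigr => z z0 do rewrite -mulr_suml inner mulrBl mul1r.
rewrite sumrB sum_chi (negbTE dv) subr0 (bigD1 1) ?oner_neq0 //= eqxx.
rewrite chi1 exp1rz mulr1 big1 ?addr0 // => z /andP[_ /negbTE ->].
by rewrite mul0r.
Qed.

End CharacterSums.

(** * The multiplicity [s_mult] *)

Lemma zetaXn (R : realType) (k n : nat) :
  zeta R k ^+ n = Complex (cos (2 * pi / k%:R * n%:R)) (sin (2 * pi / k%:R * n%:R)).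
Proof.
elim: n => [|n IH]; first by rewrite mulr0 cos0 sin0 expr0.
rewrite exprS IH /zeta -(natr1 n) !(mulrDr _ n%:R 1) mulr1 cosD sinD.
apply/eqP; rewrite eq_complex /=; apply/andP.
by split; apply/eqP; ring.
Qed.

Lemma zeta_expr1 (R : realType) (k n : nat) :
  (0 < k)%N -> (zeta R k ^+ n == 1) = (k %| n)%N.
Proof.
move=> k0; have kR : 0 < k%:R :> R by rewrite ltr0n.
have zk : zeta R k ^+ k = 1.
  rewrite zetaXn divfK ?lt0r_neq0 // mulrC mulr_natr cos2pi sin2pi //.
apply/idP/idP => [|/dvdnP[c ->]]; last by rewrite mulnC exprM zk expr1n.
rewrite {1}(divn_eq n k) exprD mulnC exprM zk expr1n mul1r.
rewrite /dvdn; case: (posnP (n %% k)) => [-> //|r0] /eqP.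
rewrite zetaXn => /eqP; rewrite eq_complex => /andP[/eqP /= c1 _]; exfalso.
pose r : R := (n %% k)%:R.
have r_gt0 : 0 < r by rewrite ltr0n.
have r_lt : r < k%:R by rewrite ltr_nat ltn_pmod.
(* [cos (2 y) = 1 - 2 sin^2 y] is 1 only if [sin y = 0], but [0 < y < pi]. *)
have := @cos_mulr2n R (pi / k%:R * r).
rewrite (_ : pi / k%:R * r *+ 2 = 2 * pi / k%:R * r); last by rewrite mulr2n; ring.
rewrite c1 cos2sin2 => e.
have s0 : sin (pi / k%:R * r) = 0.
  apply/eqP; rewrite -sqrf_eq0; apply/eqP.
  by move: e; rewrite mulr2n; lra.
have : 0 < sin (pi / k%:R * r).
  apply: sin_gt0_pi; rewrite !mulr_gt0 ?invr_gt0 ?pi_gt0 //=.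
  by rewrite -mulrA gtr_pMr ?pi_gt0 // mulrC ltr_pdivrMr // mul1r.
by rewrite s0 ltxx.
Qed.

Lemma zeta_neq0 (R : realType) (k : nat) : (0 < k)%N -> zeta R k != 0.
Proof.
move=> k0; have := zeta_expr1 R k k0; rewrite dvdnn; apply: contraTneq => ->.
by rewrite expr0n gtn_eqF // eq_sym oner_eq0.
Qed.

Lemma zeta_exprz1 (R : realType) (k : nat) (v : int) :
  (0 < k)%N -> (zeta R k ^ v == 1) = (k%:Z %| v)%Z.
Proof.
move=> k0; rewrite /dvdz absz_nat; case: v => n /=.
  by rewrite -exprnP zeta_expr1.
by rewrite NegzE -exprnN invr_eq1 zeta_expr1 // abszN.
Qed.

Lemma zeta_exprz_eq (R : realType) (k : nat) (a b : int) :
  (0 < k)%N -> (zeta R k ^ a == zeta R k ^ b) = (k%:Z %| a - b)%Z.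
Proof.
move=> k0; have zb : zeta R k ^ b != 0 by rewrite expfz_neq0 ?zeta_neq0.
rewrite -(zeta_exprz1 R _ k0) expfzDr ?zeta_neq0 // -invr_expz.
by rewrite -(inj_eq (mulIf (invr_neq0 zb))) mulfV.
Qed.

Section Multiplicity.
Variable K : numFieldType.
Implicit Types (x c : K) (p : {poly K}).

(** [X^n - c] is separable in characteristic zero when [c] is not zero. *)
Lemma mup_XnsubC x c n : (0 < n)%N -> c != 0 ->
  mup x ('X^n - c%:P) = (x ^+ n == c).
Proof.
move=> n0 c0; have pn0 : 'X^n - c%:P != 0 by rewrite monic_neq0 ?monicXnsubC.
have rootE : root ('X^n - c%:P) x = (x ^+ n == c).
  by rewrite rootE !hornerE subr_eq0.
case: eqP => [xc|/eqP xc]; last first.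
  by apply/eqP; rewrite -leqn0 mup_leq // expr1 dvdp_XsubCl rootE.
apply/eqP; rewrite eqn_leq mup_leq // mup_geq // expr1 dvdp_XsubCl rootE xc eqxx.
(* A double root would also be a root of the derivative. *)
rewrite andbT; apply: contraNN c0 => /dvdpP[r er].
have : ('X^n - c%:P)^`().[x] = 0.
  by rewrite er derivM expr2 derivM !hornerE /= subrr !(mulr0, mul0r, addr0).
rewrite derivB derivC derivXn !hornerE hornerMn hornerXn.
move/eqP; rewrite subr0 mulrn_eq0 gtn_eqF //= expf_eq0 => /andP[_ /eqP x0].
by rewrite -xc x0 expr0n gtn_eqF.
Qed.

Lemma mup_prod (I : finType) (P : pred I) (p : I -> {poly K}) x :
  (forall i, P i -> p i != 0) ->
  mup x (\prod_(i | P i) p i) = (\sum_(i | P i) mup x (p i))%N.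
Proof.
move=> p0; have [] : \prod_(i | P i) p i != 0 /\
    mup x (\prod_(i | P i) p i) = (\sum_(i | P i) mup x (p i))%N; last by [].
apply: (big_rec2 (fun q n => q != 0 /\ mup x q = n)).
  split; first exact: oner_neq0.
  by apply/eqP; rewrite -leqn0 mup_leq ?oner_neq0 // expr1 dvdp_XsubCl root1.
move=> i n q Pi [q0 <-]; split; first by rewrite mulf_neq0 ?p0.
by rewrite mupM ?p0.
Qed.

Lemma mup_gcdp p q x : p != 0 -> q != 0 ->
  mup x (gcdp p q) = minn (mup x p) (mup x q).
Proof.
move=> p0 q0; have g0 : gcdp p q != 0 by rewrite gcdp_eq0 negb_and p0.
apply/eqP; rewrite eqn_leq mup_geq // dvdp_gcd -!mup_geq // geq_minl geq_minr.
have dvd : ('X - x%:P) ^+ mup x (gcdp p q) %| gcdp p q by rewrite -mup_geq.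
rewrite leq_min !mup_geq // andbT.
by rewrite (dvdp_trans dvd (dvdp_gcdl _ _)) (dvdp_trans dvd (dvdp_gcdr _ _)).
Qed.

End Multiplicity.

(** A factor [X^|gamma_j| - zeta^(+-delta_j)] of either side of the gcd vanishes
    at [zeta^(-m)] exactly when [- gamma_j m + delta_j] is divisible by [k]. *)
Lemma s_multE (R : realType) (k n : nat) (gamma delta : 'I_n -> int) (m : int) :
  (0 < k)%N ->
  s_mult R k gamma delta (- m) =
  minn #|[set j | (gamma j < 0) && (k%:Z %| - gamma j * m + delta j)%Z]%SET|
       #|[set j | (0 < gamma j) && (k%:Z %| - gamma j * m + delta j)%Z]%SET|.
Proof.
move=> k0; rewrite /s_mult /D_poly.
have nz (N : nat) (e : int) : (0 < N)%N -> 'X^N - (zeta R k ^ e)%:P != 0.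
  by move=> N0; rewrite monic_neq0 ?monicXnsubC.
have zr (e : int) : zeta R k ^ e != 0 by rewrite expfz_neq0 ?zeta_neq0.
rewrite mup_gcdp; last first.
- by apply/prodf_neq0 => j jp; rewrite nz //; lia.
- by apply/prodf_neq0 => j jp; rewrite nz //; lia.
rewrite !mup_prod => [|j jp|j jp]; try by rewrite nz //; lia.
congr minn.
- rewrite -sum1dep_card big_mkcondr; apply: eq_bigr => j jn.
  rewrite mup_XnsubC //; last by lia.
  rewrite exprnP exprz_exp zeta_exprz_eq // (_ : _ - _ = - (- gamma j * m + delta j)).
    by rewrite dvdzE abszN -dvdzE; case: ifP.
  by rewrite ltz0_abs //; ring.
- rewrite -sum1dep_card big_mkcondr; apply: eq_bigr => j jn.
  rewrite mup_XnsubC //; last by lia.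
  rewrite exprnP exprz_exp zeta_exprz_eq // (_ : _ - _ = (- gamma j * m + delta j)).
    by case: ifP.
  by rewrite gtz0_abs //; ring.
Qed.

(** * Hypersurfaces in tori *)

Section TorusCount.
Variables (R : realType) (F : finFieldType) (psi chi : F -> R[i]).
Hypothesis psiP : nontrivial_additive_character psi.
Hypothesis chiP : multiplicative_character chi.
Hypothesis chi_order : character_order chi #|F|.-1.
Local Notation q := #|F|.
Local Notation Q := #|F|.-1.
Local Notation g := (gauss_sum psi chi).
Variables (d p : nat).
Implicit Types (x : {ffun 'I_d -> F}) (v : {ffun 'I_p -> 'I_Q}) (I : {set 'I_p}).

(** The torus of dimension [k], inside [F^d] so that all orbits can be counted
    with one index type. *)
Definition subtorus (k : nat) : {set {ffun 'I_d -> F}} :=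
  [set x : {ffun 'I_d -> F} | [forall i : 'I_d, if (i < k)%N then x i != 0 else x i == 1]]%SET.

Lemma subtorus_neq0 k x i : x \in subtorus k -> x i != 0.
Proof.
rewrite inE => /forallP/(_ i); case: ifP => // _ /eqP ->; exact: oner_neq0.
Qed.

Definition supported v I : bool := [forall j, ((v j : nat) != 0%N) ==> (j \in I)].

Lemma supportedP v I j : supported v I -> j \notin I -> v j = 0%N :> nat.
Proof. by move=> /forallP/(_ j); case: eqP => //= _ ->. Qed.

(** The relations modulo [q - 1] of degree 0 between the columns of [e]. *)
Definition relations (e : 'M[int]_(d, p)) : {set {ffun 'I_p -> 'I_Q}} :=
  [set v : {ffun 'I_p -> 'I_Q} | (Q%:Z %| \sum_j (v j : nat)%:Z)%Z &&
       [forall i, (Q%:Z %| \sum_j e i j * (v j : nat)%:Z)%Z]]%SET.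

Definition gauss_term (u : 'I_p -> F) I v : R[i] :=
  \prod_(j in I) (g (- (v j : nat)%:Z) * chi (u j) ^+ v j).

Definition monomial (e : 'M[int]_(d, p)) x j : F := \prod_i x i ^ e i j.

Lemma monomial_neq0 e x j : (forall i, x i != 0) -> monomial e x j != 0.
Proof. by move=> x0; apply/prodf_neq0 => i _; rewrite expfz_neq0. Qed.

Lemma psi_sum (J : finType) (P : pred J) (h : J -> F) :
  psi (\sum_(j | P j) h j) = \prod_(j | P j) psi (h j).
Proof.
apply: (big_morph psi); last exact: psi0.
by have [_ mul _] := psiP.
Qed.

Lemma sum_supported v I (h : 'I_p -> int) : supported v I ->
  \sum_j h j * (v j : nat)%:Z = \sum_(j in I) h j * (v j : nat)%:Z.
Proof.
move=> sv; rewrite [RHS]big_mkcond; apply: eq_bigr => j _.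
by case: ifPn => // jI; rewrite (supportedP sv jI) mulr0.
Qed.

Lemma prod_exprz (J : finType) (P : pred J) (a : R[i]) (h : J -> int) :
  a != 0 -> \prod_(j | P j) a ^ h j = a ^ (\sum_(j | P j) h j).
Proof.
move=> a0; rewrite (big_morph (fun n : int => a ^ n) (id1 := 1) (op1 := *%R)) //.
by move=> n m; rewrite expfzDr.
Qed.

(** As [psi] turns the sum into a product, each factor can be expanded in
    multiplicative characters, and these separate the variables. *)
Lemma psi_term u I e x y :
  (forall j, u j != 0) -> (forall i, x i != 0) -> y != 0 ->
  psi ((\sum_(j in I) u j * monomial e x j) * y) =
  Q%:R ^- #|I| * \sum_(v | supported v I)
    gauss_term u I v * (\prod_i chi (x i) ^ (\sum_j e i j * (v j : nat)%:Z))
                     * chi y ^ (\sum_j (v j : nat)%:Z).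
Proof.
move=> u0 x0 y0; rewrite mulr_suml psi_sum.
have t0 j : u j * monomial e x j * y != 0 by rewrite !mulf_neq0 ?monomial_neq0.
under eq_bigr => j _ do rewrite (psi_gauss psi chiP chi_order (t0 j)).
rewrite big_split /= prodr_const exprVn; congr (_ * _).
rewrite (big_distr_big (Ordinal (Q_gt0 F))) /=.
apply: eq_big => [v|v sv].
  by apply/familyP/forallP => /= h j; have := h j; case: (j \in I);
     rewrite ?implybT ?implybF ?negbK.
have {}sv : supported v I.
  apply/forallP => j; have /familyP/(_ j) /= := sv.
  by case: (j \in I); rewrite ?implybT ?implybF ?negbK.
under eq_bigr => j _.
  have -> : chi (u j * monomial e x j * y) ^+ v j =
     chi (u j) ^+ v j * \prod_i chi (x i) ^ (e i j * (v j : nat)%:Z)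
      * chi y ^ (v j : nat)%:Z.
    rewrite !(chiM chiP) ?mulf_neq0 ?monomial_neq0 // !exprMn.
    congr (_ * _ * _); rewrite (chi_prod chiP); last by move=> i; rewrite expfz_neq0.
    rewrite -prodrXl; apply: eq_bigr => i _.
    by rewrite (chiX chiP) // exprnP exprz_exp.
  rewrite !mulrA.
  over.
rewrite !big_split /= -/(gauss_term u I v); congr (_ * _ * _).
  by rewrite /gauss_term big_split.
  rewrite exchange_big; apply: eq_bigr => i _.
  by rewrite prod_exprz ?(chi_nz chiP) // (sum_supported _ sv).
rewrite prod_exprz ?(chi_nz chiP) //; congr (_ ^ _).
by have /= := sum_supported (fun=> 1) sv; rewrite -!mulr_sumr !mul1r.
Qed.

Lemma sum_subtorus k (E : 'I_d -> int) : (k <= d)%N ->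
  (forall i : 'I_d, (k <= i)%N -> E i = 0) ->
  \sum_(x in subtorus k) \prod_i chi (x i) ^ E i =
  if [forall i, (Q%:Z %| E i)%Z] then Q%:R ^+ k else 0.
Proof.
move=> kd E0.
transitivity (\prod_(i : 'I_d)
    if (i < k)%N then (if (Q%:Z %| E i)%Z then Q%:R else 0) else 1 : R[i]).
  transitivity (\prod_(i : 'I_d) \sum_(a | if (i < k)%N then a != 0 else a == 1)
     chi a ^ E i); last first.
    apply: eq_bigr => i _; case: ifP => ik; first by rewrite (sum_chi chiP).
    by rewrite big_pred1_eq (chi1 chiP) exp1rz.
  rewrite bigA_distr_big_dep; apply: eq_bigl => x.
  by rewrite inE; apply/forallP/familyP.
case: ifPn => [/forallP h|/forallPn[i ni]].
  under eq_bigr => i _ do rewrite h.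
  rewrite -big_mkcond prodr_const; congr (_ ^+ _).
  by rewrite -[RHS]card_ord -[RHS]sum1_card (big_ord_widen d (fun=> 1%N) kd) sum1_card.
rewrite (bigD1 i) //= (negbTE ni) ifT ?mul0r //.
by rewrite ltnNge; apply: contra ni => /E0 ->; rewrite dvdz0.
Qed.

(** The sum over [y] of [psi (f x * y)] is [q] at the zeros of [f] and 0
    elsewhere. Its part [y = 0] counts the torus; in the expansion [psi_term] of
    the rest, summing over [y] and over the torus leaves the relations. *)
Lemma torus_count u I (e : 'M[int]_(d, p)) k :
  (forall j, u j != 0) -> (k <= d)%N ->
  (forall (i : 'I_d) j, (k <= i)%N -> j \in I -> e i j = 0) ->
  q%:R * #|[set x in subtorus k | \sum_(j in I) u j * monomial e x j == 0]%SET|%:R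
  = Q%:R ^+ k + Q%:R ^- #|I| * Q%:R ^+ k.+1 *
    \sum_(v in relations e | supported v I) gauss_term u I v.
Proof.
move=> u0 kd e0.
have sv0 v (i : 'I_d) : supported v I -> (k <= i)%N -> \sum_j e i j * (v j : nat)%:Z = 0.
  by move=> sv ki; rewrite (sum_supported _ sv) big1 // => j /(e0 _ _ ki) ->; rewrite mul0r.
pose f x := \sum_(j in I) u j * monomial e x j.
have -> : q%:R * #|[set x in subtorus k | f x == 0]%SET|%:R =
    \sum_(x in subtorus k) \sum_y psi (f x * y) :> R[i].
  rewrite -sum1dep_card natr_sum mulr_sumr big_mkcondr.
  by apply: eq_bigr => x _; rewrite (sum_psi psiP); case: ifP; rewrite ?mulr1.
under eq_bigr => x _ do rewrite (bigD1 0) //= mulr0 (psi0 psiP).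
rewrite big_split /=; congr (_ + _).
  have := @sum_subtorus k (fun=> 0) kd (fun _ _ => erefl).
  rewrite ifT; last by apply/forallP => i; rewrite dvdz0.
  by move=> <-; apply: eq_bigr => x _; rewrite big1.
have expand x : x \in subtorus k -> \sum_(y | y != 0) psi (f x * y) =
    Q%:R ^- #|I| * \sum_(v | supported v I) \sum_(y | y != 0)
    gauss_term u I v * (\prod_i chi (x i) ^ (\sum_j e i j * (v j : nat)%:Z))
                     * chi y ^ (\sum_j (v j : nat)%:Z).
  move=> xk; rewrite exchange_big mulr_sumr; apply: eq_bigr => y y0.
  by rewrite psi_term // => i; apply: (subtorus_neq0 i xk).
rewrite (eq_bigr _ expand) -mulr_sumr -mulrA; congr (_ * _).
rewrite exchange_big mulr_sumr [RHS]big_mkcondl; apply: eq_bigr => v sv /=.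
under eq_bigr do rewrite -mulr_sumr (sum_chi chiP chi_order).
rewrite -mulr_suml -mulr_sumr sum_subtorus //; last by move=> i; exact: sv0.
rewrite inE exprS; case: ifP => h1; case: ifP => h2 //=; rewrite ?mulr0 ?mul0r //.
by rewrite mulrC [_ * Q%:R ^+ k]mulrC mulrA.
Qed.

End TorusCount.

(** * Walls *)

Section Walls.
Variables (d n : nat) (gamma : 'I_n -> int) (N : 'M[int]_(n, d)).
Implicit Types (a b : 'cV[int]_d) (K I : {set 'I_n}) (i j k p : 'I_n).

(** For the matrices [N] used below, [nu a] expresses a fixed multiple of [a] as
    a combination of exponents with coefficients of sum 0. *)
Definition nu a j : int := (N *m a) j 0.

(** When [gamma p] and [gamma k] have opposite signs, this is up to scaling the
    inner normal of the facet opposite to [p] and [k]. It does not change when a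
    multiple of [gamma] is added to [nu a], so it is intrinsic. *)
Definition wall p k a : int := nu a k * gamma p - nu a p * gamma k.

Lemma nuD a b j : nu (a + b) j = nu a j + nu b j.
Proof. by rewrite /nu mulmxDr mxE. Qed.

Lemma nuN a j : nu (- a) j = - nu a j.
Proof. by rewrite /nu mulmxN mxE. Qed.

Lemma wallD p k a b : wall p k (a + b) = wall p k a + wall p k b.
Proof. by rewrite /wall !nuD; ring. Qed.

Lemma wallN p k a : wall p k (- a) = - wall p k a.
Proof. by rewrite /wall !nuN; ring. Qed.

Lemma nuZ (t : int) a j : nu (t *: a) j = t * nu a j.
Proof. by rewrite /nu -scalemxAr mxE. Qed.

Lemma wallZ p k (t : int) a : wall p k (t *: a) = t * wall p k a.
Proof. by rewrite /wall !nuZ; ring. Qed.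

Lemma wall0 p k : wall p k 0 = 0.
Proof. by have := wallD p k 0 0; rewrite addr0; lia. Qed.

Lemma wallMn p k a l : wall p k (a *+ l) = wall p k a * l%:Z.
Proof.
elim: l => [|l IH]; first by rewrite mulr0n wall0 mulr0.
by rewrite mulrS wallD IH; lia.
Qed.

Lemma wall_sum (J : finType) (P : pred J) (h : J -> 'cV[int]_d) p k :
  wall p k (\sum_(i | P i) h i) = \sum_(i | P i) wall p k (h i).
Proof. exact: (big_morph (wall p k) (wallD p k) (wall0 p k)). Qed.

(** The complement of [{p, k}] is a facet, and it contains [K]. *)
Definition facet K p k : bool :=
  [&& 0 < gamma p, gamma k < 0, p \notin K & k \notin K].

(** The exponents in the dual of the normal cone of [K]. *)
Definition cone_monoid K a : bool :=
  [forall p, forall k, facet K p k ==> (0 <= wall p k a)].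

(** The exponents in the linear span of the directions of the face [I]. *)
Definition span_lattice I a : bool :=
  [forall p, forall k, facet I p k ==> (wall p k a == 0)].

Lemma cone_monoidP K a :
  reflect (forall p k, facet K p k -> 0 <= wall p k a) (cone_monoid K a).
Proof.
apply: (iffP forallP) => [h p k f|h p]; last by apply/forallP => k; apply/implyP; exact: h.
by move/(_ p)/forallP/(_ k)/implyP: h; apply.
Qed.

Lemma span_latticeP I a :
  reflect (forall p k, facet I p k -> wall p k a = 0) (span_lattice I a).
Proof.
apply: (iffP forallP) => [h p k f|h p].
  by move/(_ p)/forallP/(_ k)/implyP: h => h; apply/eqP/h.
by apply/forallP => k; apply/implyP => /h ->.
Qed.

Lemma facet_sub K I p k : K \subset I -> facet I p k -> facet K p k.
Proof.
move=> /fintype.subsetP KI /and4P[gp gk pI kI]; rewrite /facet gp gk /=.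
by apply/andP; split; [apply: contra pI|apply: contra kI]; exact: KI.
Qed.

Lemma cone_monoid_sub K I a : K \subset I -> cone_monoid K a -> cone_monoid I a.
Proof.
by move=> KI /cone_monoidP h; apply/cone_monoidP => p k /(facet_sub KI)/h.
Qed.

Lemma cone_monoid0 K : cone_monoid K 0.
Proof. by apply/cone_monoidP => p k _; rewrite wall0. Qed.

Lemma cone_monoidD K a b :
  cone_monoid K a -> cone_monoid K b -> cone_monoid K (a + b).
Proof.
move=> /cone_monoidP ha /cone_monoidP hb; apply/cone_monoidP => p k f.
by rewrite wallD addr_ge0 ?ha ?hb.
Qed.

Lemma cone_monoidMn K a l : cone_monoid K a -> cone_monoid K (a *+ l).
Proof.
move=> /cone_monoidP ha; apply/cone_monoidP => p k f.
by rewrite wallMn mulr_ge0 ?ha.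
Qed.

Lemma span_lattice0 I : span_lattice I 0.
Proof. by apply/span_latticeP => p k _; rewrite wall0. Qed.

Lemma span_latticeD I a b :
  span_lattice I a -> span_lattice I b -> span_lattice I (a + b).
Proof.
move=> /span_latticeP ha /span_latticeP hb; apply/span_latticeP => p k f.
by rewrite wallD ha ?hb.
Qed.

Lemma span_latticeN I a : span_lattice I a -> span_lattice I (- a).
Proof.
by move=> /span_latticeP ha; apply/span_latticeP => p k f; rewrite wallN ha ?oppr0.
Qed.

Lemma span_lattice_cone I a : span_lattice I a -> cone_monoid I a.
Proof. by move=> /span_latticeP h; apply/cone_monoidP => p k /h ->. Qed.

(** The walls are non-negative on [cone_monoid K], so they vanish on both terms
    of a sum if they vanish on the sum: the lattice cuts a face of the monoid. *)
Lemma span_lattice_face K I a b : K \subset I -> cone_monoid K a ->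
  cone_monoid K b -> span_lattice I (a + b) = span_lattice I a && span_lattice I b.
Proof.
move=> KI /(cone_monoid_sub KI)/cone_monoidP ha /(cone_monoid_sub KI)/cone_monoidP hb.
apply/idP/andP => [/span_latticeP h|[]]; last exact: span_latticeD.
by split; apply/span_latticeP => p k f; have := h p k f; rewrite wallD;
   have := ha p k f; have := hb p k f; lia.
Qed.

(** By Gale duality a non-empty set of vertices spans a proper face when the
    complement has [gamma] of both signs: a function that is 0 on [I] and
    positive off [I] can then be made orthogonal to [gamma]. *)
Definition is_face I : bool :=
  (I != finset.set0) && ((I == [set: 'I_n]%SET) || [exists p, exists k, facet I p k]).

End Walls.

(** The matrix [N] divides by [D] in the space of exponents: it lifts [D a] to
    coefficients of sum 0 on the columns of [m]. Such coefficients are unique up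
    to multiples of [gamma]. *)
Record gale_splitting (d n : nat) (m : 'M[int]_(d, n)) (gamma : 'I_n -> int)
    (D : int) (N : 'M[int]_(n, d)) : Prop := GaleSplitting {
  gale_sum : \sum_j gamma j = 0;
  gale_rel : forall i, \sum_j m i j * gamma j = 0;
  gale_neq0 : forall j, gamma j != 0;
  splitting_gt0 : 0 < D;
  splitting_mul : m *m N = D%:M;
  splitting_sum : forall i, \sum_j N j i = 0;
  relation_gale : forall v : 'cV[int]_n, m *m v = 0 -> \sum_j v j 0 = 0 ->
    forall i j, v i 0 * gamma j = v j 0 * gamma i }.

Section GaleSplitting.
Variables (d n : nat) (m : 'M[int]_(d, n)) (gamma : 'I_n -> int).
Variables (D : int) (N : 'M[int]_(n, d)).
Hypothesis G : gale_splitting m gamma D N.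
Let gamma_sum := gale_sum G.
Let gamma_rel := gale_rel G.
Let gamma_neq0 := gale_neq0 G.
Let D_gt0 := splitting_gt0 G.
Let mN := splitting_mul G.
Let sumN := splitting_sum G.
Let rel_gamma := relation_gale G.
Implicit Types (a b : 'cV[int]_d) (K I : {set 'I_n}) (i j k p : 'I_n).
Local Notation wall := (wall gamma N).
Local Notation nu := (nu N).
Local Notation facet := (facet gamma).
Local Notation is_face := (is_face gamma).
Local Notation cone_monoid := (cone_monoid gamma N).
Local Notation span_lattice := (span_lattice gamma N).
Local Notation mu j := (col j m).

Lemma nu_sum a : \sum_j nu a j = 0.
Proof.
rewrite /nu; under eq_bigr do rewrite mxE.
by rewrite exchange_big big1 // => i _; rewrite -mulr_suml sumN mul0r.
Qed.

Lemma nu_rel a (i : 'I_d) : \sum_j nu a j * m i j = D * a i 0.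
Proof.
have : (m *m (N *m a)) i 0 = D * a i 0 by rewrite mulmxA mN mul_scalar_mx mxE.
by rewrite mxE => <-; apply: eq_bigr => j _; rewrite mulrC.
Qed.

(** Both [nu (mu j - mu i)] and [D (e_j - e_i)] express [D (mu j - mu i)], so
    they differ by a multiple of [gamma], which the wall does not see. *)
Lemma wall_mu p k i j :
  wall p k (mu j - mu i) = D * (((j == k)%:Z - (i == k)%:Z) * gamma p
                                - ((j == p)%:Z - (i == p)%:Z) * gamma k).
Proof.
pose e : 'cV[int]_n := delta_mx j 0 - delta_mx i 0.
pose v : 'cV[int]_n := N *m (mu j - mu i) - D *: e.
have me : m *m e = mu j - mu i by rewrite mulmxBr -!colE.
have mv : m *m v = 0.
  by rewrite mulmxBr mulmxA mN mul_scalar_mx -scalemxAr me subrr.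
have sumdelta l : \sum_j0 (delta_mx l 0 : 'cV[int]_n) j0 0 = 1.
  rewrite (bigD1 l) //= big1 ?addr0 ?mxE ?eqxx // => j0 /negbTE jl.
  by rewrite mxE jl.
have v1 : \sum_j0 v j0 0 = 0.
  under eq_bigr => j0 _ do rewrite mxE [(- (D *: e)) _ _]mxE [(D *: e) _ _]mxE.
  rewrite big_split /= -[X in X + _]/(\sum_j0 nu (mu j - mu i) j0) nu_sum add0r.
  rewrite sumrN -mulr_sumr.
  under eq_bigr => j0 _ do rewrite mxE [(- delta_mx _ _) _ _]mxE.
  by rewrite sumrB !sumdelta subrr mulr0 oppr0.
have := rel_gamma mv v1 k p.
have vE l : v l 0 = nu (mu j - mu i) l - D * ((l == j)%:Z - (l == i)%:Z).
  by rewrite !mxE !andbT !natz /nu mxE.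
rewrite !vE /wall ![_ == j]eq_sym ![_ == i]eq_sym; lia.
Qed.

Lemma mu_cone K i j : i \in K -> cone_monoid K (mu j - mu i).
Proof.
move=> iK; apply/cone_monoidP => p k /and4P[gp gk pK kK]; rewrite wall_mu.
rewrite (_ : (i == k) = false); last by apply: contraNF kK => /eqP <-.
rewrite (_ : (i == p) = false); last by apply: contraNF pK => /eqP <-.
by apply: mulr_ge0; [lia|case: (j == k); case: (j == p); lia].
Qed.

Lemma mu_span I i j : is_face I -> i \in I -> span_lattice I (mu j - mu i) = (j \in I).
Proof.
move=> /andP[_ fI] iI.
have ni l : l \notin I -> (i == l) = false by apply: contraNF => /eqP <-.
apply/idP/idP => [/span_latticeP h|jI]; last first.
  apply/span_latticeP => p k /and4P[_ _ pI kI]; rewrite wall_mu !ni //.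
  rewrite (_ : (j == k) = false); last by apply: contraNF kI => /eqP <-.
  rewrite (_ : (j == p) = false); last by apply: contraNF pI => /eqP <-.
  by rewrite subrr !mul0r subrr mulr0.
case/orP: fI => [/eqP ->|/existsP[p /existsP[k f]]]; first by rewrite inE.
apply/negPn/negP => jI; have /and4P[gp gk pI kI] := f.
have [gj|gj] : 0 < gamma j \/ gamma j < 0 by have := gamma_neq0 j; lia.
  have /h : facet I j k by apply/and4P.
  rewrite wall_mu !ni // eqxx (_ : (j == k) = false); last by apply/eqP => e; move: gj gk; rewrite e; lia.
  nia.
have /h : facet I p j by apply/and4P.
rewrite wall_mu !ni // eqxx (_ : (j == p) = false); last by apply/eqP => e; move: gj gp; rewrite e; lia.
nia.
Qed.

Lemma sum_combination (s t : int) a :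
  \sum_j (s * nu a j + t * gamma j) = 0.
Proof. by rewrite big_split /= -!mulr_sumr nu_sum gamma_sum !mulr0 addr0. Qed.

(** Adding multiples of [gamma] to the coefficients changes nothing. *)
Lemma combination (s t : int) a i :
  \sum_j (s * nu a j + t * gamma j) *: (mu j - mu i) = (s * D) *: a.
Proof.
under eq_bigr do rewrite scalerBr.
rewrite sumrB -scaler_suml sum_combination scale0r subr0; apply/colP => l.
rewrite summxE mxE -mulrA -nu_rel.
have -> : s * (\sum_j nu a j * m l j) =
    s * (\sum_j nu a j * m l j) + t * (\sum_j m l j * gamma j).
  by rewrite gamma_rel mulr0 addr0.
rewrite !mulr_sumr -big_split; apply: eq_bigr => j _.
by rewrite !mxE /=; ring.
Qed.

(** Farkas: an element of [cone_monoid K] is a combination of the [mu j] with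
    non-negative coefficients outside [K]; the freedom is to add a multiple of
    [gamma], and the walls say that the constraints on this multiple are
    compatible. *)
Lemma cone_monoid_coef K a : cone_monoid K a ->
  exists s t : int, 0 < s /\ forall j, j \notin K -> 0 <= s * nu a j + t * gamma j.
Proof.
move=> /cone_monoidP ha.
case: (pickP [pred p | (p \notin K) && (0 < gamma p)]) => [p0 /= Pp0|no]; last first.
  pose T := \sum_j `|nu a j|.
  (* Off [K] there are negative indices only, where any large multiple works. *)
  exists 1, (- T); split=> // j jK; have := no j; rewrite inE /= jK /= => /negbT gj.
  have : `|nu a j| <= T.
    by rewrite /T (bigD1 j) //= lerDl sumr_ge0.
  have := gamma_neq0 j; have : 0 <= T by apply: sumr_ge0.
  nia.
pose ratio p : rat := (nu a p)%:~R / (gamma p)%:~R.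
have [p /andP[pK gp] pmin] : exists2 p, (p \notin K) && (0 < gamma p) &
    forall j, (j \notin K) && (0 < gamma j) -> ratio p <= ratio j.
  case: (@arg_minP _ _ _ p0 [pred p | (p \notin K) && (0 < gamma p)] ratio Pp0) => p Pp hp.
  by exists p.
(* At [j] positive this is the minimality of [p], at [j] negative it is
   [wall p j a >= 0]. *)
exists (gamma p), (- nu a p); split=> // j jK.
have [gj|gj] : 0 < gamma j \/ gamma j < 0 by have := gamma_neq0 j; lia.
  have := pmin j; rewrite jK gj => /(_ isT).
  rewrite /ratio ler_pdivrMr ?ltr0z // mulrAC ler_pdivlMr ?ltr0z //.
  by rewrite -!intrM ler_int; nia.
have /ha : facet K p j by apply/and4P.
by rewrite /wall; nia.
Qed.
End GaleSplitting.

(** * The normal fan *)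

Section RealCones.
Variables (d n : nat) (m : 'M[int]_(d, n)) (gamma : 'I_n -> int).
Variables (D : int) (N : 'M[int]_(n, d)).
Hypothesis G : gale_splitting m gamma D N.
Variable R : realType.
Implicit Types (a b : 'cV[int]_d) (K I : {set 'I_n}) (i j k p : 'I_n).
Implicit Types (x y : 'cV[R]_d).
Local Notation mu j := (col j m).
Local Notation real a := (map_mx intr a : 'cV[R]_d).
Local Notation wall := (wall gamma N).
Local Notation P := (newton_polytope R m).

Lemma dotDl x y z : dot (x + y) z = dot x z + dot y z :> R.
Proof.
by rewrite /dot -big_split; apply: eq_bigr => i _; rewrite mxE mulrDl.
Qed.

Lemma dotZl (t : R) x y : dot (t *: x) y = t * dot x y.
Proof.
by rewrite /dot mulr_sumr; apply: eq_bigr => i _; rewrite mxE mulrA.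
Qed.

Lemma dot_suml (J : finType) (Q : pred J) (h : J -> 'cV[R]_d) y :
  dot (\sum_(j | Q j) h j) y = \sum_(j | Q j) dot (h j) y.
Proof.
apply: (big_morph (fun x => dot x y)) => [x z|]; first exact: dotDl.
by rewrite /dot big1 // => i _; rewrite mxE mul0r.
Qed.

(** The normal cone of the face spanned by [K], and in general of the smallest
    face containing [K]: this extension to all subsets makes the intersection
    of two cones a cone of the same form. *)
Definition cone K : set 'cV[R]_d :=
  [set y | forall i j, i \in K -> dot (real (mu i)) y <= dot (real (mu j)) y].

Lemma coneU K I : cone K `&` cone I = cone (K :|: I).
Proof.
apply/seteqP; split=> y /= => [[hK hI] i j|h].
  by rewrite inE => /orP[/hK|/hI]; apply.
by split=> i j iK; apply: h; rewrite inE iK ?orbT.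
Qed.

Lemma newton_polytope_vertex j : P (real (mu j)).
Proof.
exists (fun i => (i == j)%:R); split.
- by move=> i; rewrite ler0n.
- by rewrite (bigD1 j) //= eqxx big1 ?addr0 // => i /negbTE ->.
- rewrite (bigD1 j) //= eqxx scale1r big1 ?addr0 // => i /negbTE ->.
  by rewrite scale0r.
Qed.

Definition argmin y : {set 'I_n} :=
  [set i | [forall j, dot (real (mu i)) y <= dot (real (mu j)) y]]%SET.

Lemma argminP y i :
  reflect (forall j, dot (real (mu i)) y <= dot (real (mu j)) y) (i \in argmin y).
Proof. by rewrite inE; apply: forallP. Qed.

Lemma face_vertex y i : i \in argmin y -> face P y (real (mu i)).
Proof.
move=> /argminP h; split; first exact: newton_polytope_vertex.
move=> _ [t [t0 t1 ->]]; rewrite dot_suml.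
have -> : dot (real (mu i)) y = \sum_j t j * dot (real (mu i)) y.
  by rewrite -mulr_suml t1 mul1r.
by apply: ler_sum => j _; rewrite dotZl ler_wpM2l ?h.
Qed.

Lemma argmin_neq0 y : (0 < n)%N -> argmin y != finset.set0.
Proof.
move=> n0; pose i0 := Ordinal n0.
case: (@arg_minP _ _ _ i0 predT (fun j => dot (real (mu j)) y) isT) => i _ h.
by apply/set0Pn; exists i; apply/argminP => j; exact: h.
Qed.

(** A point of the polytope is minimal for [y] only if its weights are carried
    by the minimal vertices. *)
Lemma normal_cone_face y : (0 < n)%N -> normal_cone P (face P y) = cone (argmin y).
Proof.
move=> n0; apply/seteqP; split=> z /=.
  move=> h i j /face_vertex/h[_]; apply; exact: newton_polytope_vertex.
have /set0Pn[i0 i0P] := argmin_neq0 y n0.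
move=> h x [[t [t0 t1 ->]] xmin]; split; first by exists t.
have tzero j : j \notin argmin y -> t j = 0.
  move=> jmin; apply/eqP; apply: contraNT jmin => tj.
  have tj0 : 0 < t j by rewrite lt_def tj t0.
  apply/argminP => j'; apply: le_trans (_ : dot (real (mu i0)) y <= _); last first.
    exact/argminP.
  have le1 := xmin _ (newton_polytope_vertex i0).
  have e : dot (real (mu i0)) y = \sum_j t j * dot (real (mu i0)) y.
    by rewrite -mulr_suml t1 mul1r.
  rewrite e dot_suml (bigD1 j) //= [leRHS](bigD1 j) //= dotZl in le1.
  have le2 : \sum_(l | l != j) t l * dot (real (mu i0)) y <=
             \sum_(l | l != j) dot (t l *: real (mu l)) y.
    by apply: ler_sum => l _; rewrite dotZl ler_wpM2l //; exact/argminP.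
  by rewrite -(ler_pM2l tj0); move: le1 le2; lra.
move=> _ [s [s0 s1 ->]]; rewrite !dot_suml.
apply: (@le_trans _ _ (dot (real (mu i0)) z)).
  have -> : dot (real (mu i0)) z = \sum_j t j * dot (real (mu i0)) z.
    by rewrite -mulr_suml t1 mul1r.
  apply: ler_sum => j _; rewrite dotZl.
  case: (boolP (j \in argmin y)) => [jmin|/tzero ->]; last by rewrite !mul0r.
  by rewrite ler_wpM2l ?h.
have -> : dot (real (mu i0)) z = \sum_j s j * dot (real (mu i0)) z.
  by rewrite -mulr_suml s1 mul1r.
apply: ler_sum => j _.
by rewrite dotZl ler_wpM2l ?h.
Qed.

(** Pairing with this vector is the wall of [p] and [k], see [dot_ray]. *)
Definition ray p k : 'cV[R]_d := \col_i (wall p k (delta_mx i 0))%:~R.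

Lemma dot_ray p k a : dot (real a) (ray p k) = (wall p k a)%:~R.
Proof.
rewrite /dot {2}[a]matrix_sum_delta (wall_sum gamma N).
under [in RHS]eq_bigr do rewrite big_ord1.
rewrite rmorph_sum; apply: eq_bigr => i _.
by rewrite !mxE -intrM wallZ.
Qed.

Lemma dotB_ray p k i j :
  dot (real (mu j)) (ray p k) - dot (real (mu i)) (ray p k)
  = (wall p k (mu j - mu i))%:~R.
Proof. by rewrite wallD wallN rmorphD rmorphN /= !dot_ray. Qed.

Lemma ray_cone K p k : facet gamma K p k -> cone K (ray p k).
Proof.
move=> f i j iK; rewrite -subr_ge0 dotB_ray ler0z.
by have /cone_monoidP := mu_cone G j iK; apply.
Qed.

Lemma sum_gamma_dot (y : 'cV[R]_d) (s : R) :
  \sum_j (gamma j)%:~R * (dot (real (mu j)) y - s) = 0.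
Proof.
under eq_bigr do rewrite mulrBr.
rewrite sumrB -mulr_suml -rmorph_sum (gale_sum G) mul0r subr0 /dot.
under eq_bigr do rewrite mulr_sumr.
rewrite exchange_big big1 //= => i _.
under eq_bigr => j _ do rewrite mxE mulrA mxE -intrM [gamma j * _]mulrC.
by rewrite -mulr_suml -rmorph_sum (gale_rel G) mul0r.
Qed.

Lemma sum_nu_dot a (y : 'cV[R]_d) (s : R) :
  \sum_j (nu N a j)%:~R * (dot (real (mu j)) y - s) = D%:~R * dot (real a) y.
Proof.
under eq_bigr do rewrite mulrBr.
rewrite sumrB -mulr_suml -rmorph_sum (nu_sum G) mul0r subr0 /dot mulr_sumr.
under eq_bigr do rewrite mulr_sumr.
rewrite exchange_big; apply: eq_bigr => i _ /=.
under eq_bigr => j _ do rewrite mxE mulrA mxE -intrM.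
by rewrite -mulr_suml -rmorph_sum (nu_rel G) mxE rmorphM mulrA.
Qed.

(** Let [w >= 0] be the values of [y] on the exponents, with minimum 0. They are
    orthogonal to [gamma], so their positive and negative parts weigh the same
    [W], and [W] times the value of [y] at [a] is
    [\sum_p \sum_k w_p w_k wall p k a]. *)
Lemma dual_monoid_cone K a :
  K != finset.set0 -> dual_monoid (cone K) a <-> cone_monoid gamma N K a.
Proof.
move=> /set0Pn[i0 i0K]; split.
  move=> h; apply/cone_monoidP => p k f; have := h _ (ray_cone f).
  by rewrite dot_ray ler0z.
move=> /cone_monoidP h y yK.
pose w j : R := dot (real (mu j)) y - dot (real (mu i0)) y.
have w_ge0 j : 0 <= w j by rewrite subr_ge0 yK.
have w0 j : j \in K -> w j = 0.
  by move=> jK; apply/eqP; rewrite eq_le w_ge0 subr_le0 yK.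
pose c j : R := (gamma j)%:~R * w j.
have cN j : 0 < gamma j -> 0 <= c j by move=> gj; rewrite mulr_ge0 // ler0z ltW.
have csum : \sum_j c j = 0 by exact: sum_gamma_dot.
have nusum : \sum_j (nu N a j)%:~R * w j = D%:~R * dot (real a) y by exact: sum_nu_dot.
have D0 : 0 < D%:~R :> R by rewrite ltr0z (splitting_gt0 G).
rewrite -(pmulr_rge0 _ D0) -nusum.
have split2 (e : 'I_n -> R) : \sum_j e j =
    \sum_(j | 0 < gamma j) e j + \sum_(j | gamma j < 0) e j.
  rewrite (bigID (fun j => 0 < gamma j)) /=; congr (_ + _); apply: eq_bigl => j.
  by have := gale_neq0 G j; lia.
pose W := \sum_(j | 0 < gamma j) c j.
have WN : \sum_(j | gamma j < 0) c j = - W.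
  by apply/eqP; rewrite -addr_eq0 addrC -split2 csum.
have W_ge0 : 0 <= W by apply: sumr_ge0.
have [W0|W0] := eqVneq W 0.
  rewrite big1 // => j _; suff -> : w j = 0 by rewrite mulr0.
  have nz : (gamma j)%:~R != 0 :> R by rewrite intr_eq0 (gale_neq0 G).
  apply: (mulfI nz); rewrite mulr0; change (c j = 0).
  have [gj|gj] : 0 < gamma j \/ gamma j < 0 by have := gale_neq0 G j; lia.
    apply/eqP; rewrite eq_le cN // andbT -W0 /W (bigD1 j) //= lerDl.
    by apply: sumr_ge0 => i /andP[/cN].
  apply/eqP; rewrite eq_le; apply/andP; split.
    by rewrite mulr_le0_ge0 // lerz0 ltW.
  rewrite -oppr0 -W0 -WN (bigD1 j) //= gerDl sumr_le0 // => i /andP[gi _].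
  by rewrite mulr_le0_ge0 // lerz0 ltW.
have {W0}W_gt0 : 0 < W by rewrite lt_def W0.
rewrite -(pmulr_rge0 _ W_gt0).
have -> : W * \sum_j (nu N a j)%:~R * w j =
  \sum_(p | 0 < gamma p) \sum_(k | gamma k < 0) (w p * w k) * (wall p k a)%:~R.
  rewrite split2 mulrDr.
  rewrite -[W in W * \sum_(j | 0 < _) _]opprK -WN mulNr addrC /W.
  rewrite !big_distrlr /= [X in - X]exchange_big /= -sumrB; apply: eq_bigr => p _.
  rewrite -sumrB; apply: eq_bigr => k _.
  by rewrite /wall /c rmorphB !rmorphM /=; ring.
apply: sumr_ge0 => p gp; apply: sumr_ge0 => k gk.
case: (boolP (p \in K)) => [/w0 ->|pK]; first by rewrite !mul0r.
case: (boolP (k \in K)) => [/w0 ->|kK]; first by rewrite mulr0 mul0r.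
by rewrite !mulr_ge0 ?w_ge0 // ler0z h //; apply/and4P.
Qed.

(** On the vertices, the sum of the rays of the facets containing a face takes
    its minimum exactly on the face. *)
Lemma normal_fan_face I : is_face gamma I -> normal_fan P (cone I).
Proof.
move=> fI; have /andP[/set0Pn[i0 i0I] _] := fI.
have n0 : (0 < n)%N by exact: leq_ltn_trans (leq0n _) (ltn_ord i0).
pose y := \sum_p \sum_(k | facet gamma I p k) ray p k.
have dotE j : dot (real (mu j)) y - dot (real (mu i0)) y =
   \sum_p \sum_(k | facet gamma I p k) (wall p k (mu j - mu i0))%:~R.
  have dotr x : dot x y = \sum_p \sum_(k | facet gamma I p k) dot x (ray p k).
    rewrite /dot /y; under [in RHS]eq_bigr => p _ do rewrite exchange_big.
    rewrite exchange_big; apply: eq_bigr => i _.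
    rewrite summxE mulr_sumr; apply: eq_bigr => p _.
    by rewrite summxE mulr_sumr.
  rewrite !dotr -sumrB; apply: eq_bigr => p _; rewrite -sumrB.
  by apply: eq_bigr => k _; rewrite dotB_ray.
have ge0 j p k : facet gamma I p k -> 0 <= (wall p k (mu j - mu i0))%:~R :> R.
  by move=> f; rewrite ler0z; have /cone_monoidP := mu_cone G j i0I; apply.
have y_ge0 j : 0 <= dot (real (mu j)) y - dot (real (mu i0)) y.
  by rewrite dotE; apply: sumr_ge0 => p _; apply: sumr_ge0 => k; exact: ge0.
exists y; rewrite normal_cone_face //; congr cone; apply/setP => j.
rewrite -(mu_span G j fI i0I); apply/idP/idP.
  move/span_latticeP => h; apply/argminP => i; rewrite -[leRHS](subrK (dot (real (mu i0)) y)).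
  suff -> : dot (real (mu j)) y = dot (real (mu i0)) y by rewrite lerDr.
  apply/eqP; rewrite -subr_eq0 dotE big1 // => p _; rewrite big1 // => k f.
  by rewrite h.
move=> /argminP/(_ i0); rewrite -subr_le0 => le0.
have {le0} : dot (real (mu j)) y - dot (real (mu i0)) y = 0.
  by apply/eqP; rewrite eq_le le0 y_ge0.
rewrite dotE => /eqP; rewrite psumr_eq0 => [/allP h|p _]; last first.
  by apply: sumr_ge0 => k; exact: ge0.
apply/span_latticeP => p k f; have := h p; rewrite mem_index_enum => /(_ isT) /=.
rewrite psumr_eq0 => [/allP/(_ k)|k' ]; last exact: ge0.
by rewrite mem_index_enum f /= intr_eq0 => /(_ isT)/eqP.
Qed.

End RealCones.

(** * Points of charts and of torus orbits *)

Section Orbits.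
Variables (d n : nat) (m : 'M[int]_(d, n)) (gamma : 'I_n -> int).
Variables (D : int) (N : 'M[int]_(n, d)).
Hypothesis G : gale_splitting m gamma D N.
Variable F : fieldType.
Implicit Types (a b : 'cV[int]_d) (K I : {set 'I_n}) (i j k p : 'I_n).
Implicit Types (phi theta : 'cV[int]_d -> F).
Local Notation mu j := (col j m).
Local Notation wall := (wall gamma N).
Local Notation facet := (facet gamma).
Local Notation is_face := (is_face gamma).
Local Notation cone_monoid := (cone_monoid gamma N).
Local Notation span_lattice := (span_lattice gamma N).

(** A rational point of the affine toric variety of the monoid. *)
Definition monoid_point K phi : Prop :=
  [/\ phi 0 = 1,
      forall a b, cone_monoid K a -> cone_monoid K b -> phi (a + b) = phi a * phi b
    & forall a, ~~ cone_monoid K a -> phi a = 0].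

(** A rational point of the torus of [span_lattice I], extended by 0. *)
Definition orbit_point I theta : Prop :=
  [/\ theta 0 = 1,
      forall a b, span_lattice I a -> span_lattice I b -> theta (a + b) = theta a * theta b
    & forall a, ~~ span_lattice I a -> theta a = 0].

Section MonoidPoint.
Variables (K : {set 'I_n}) (phi : 'cV[int]_d -> F).
Hypothesis phiP : monoid_point K phi.

Lemma monoid_pointMn a l : cone_monoid K a -> phi (a *+ l) = phi a ^+ l.
Proof.
have [phi0 phiD _] := phiP => Ka; elim: l => [|l IH]; first by rewrite mulr0n expr0.
by rewrite mulrS exprS phiD ?cone_monoidMn // IH.
Qed.

Lemma monoid_point_sum (J : finType) (P : pred J) (h : J -> 'cV[int]_d) :
  (forall e, P e -> cone_monoid K (h e)) ->
  cone_monoid K (\sum_(e | P e) h e) /\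
  phi (\sum_(e | P e) h e) = \prod_(e | P e) phi (h e).
Proof.
have [phi0 phiD _] := phiP => Kh.
apply: (big_rec2 (fun a z => cone_monoid K a /\ phi a = z)).
  by rewrite cone_monoid0.
move=> e z a Pe [Ka <-]; split; first by rewrite cone_monoidD ?Kh.
by rewrite phiD ?Kh.
Qed.

Variable i0 : 'I_n.
Hypothesis i0K : i0 \in K.

(** The face whose orbit contains the point. *)
Definition support_face : {set 'I_n} := [set j | phi (mu j - mu i0) != 0]%SET.

Lemma support_face_sub : K \subset support_face.
Proof.
have [phi0 phiD _] := phiP.
apply/fintype.subsetP => j jK; rewrite inE; apply: contraTneq (oner_neq0 F) => z.
rewrite -phi0 -(subrr (mu j - mu i0)) opprB phiD ?mu_cone //; try exact: (mu_cone G).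
by rewrite z mul0r eqxx.
Qed.

Lemma support_face_sum (c : 'I_n -> nat) :
  phi (\sum_j (mu j - mu i0) *+ c j) != 0 <->
  forall j, j \notin support_face -> c j = 0%N.
Proof.
have Kc j : cone_monoid K ((mu j - mu i0) *+ c j) by rewrite cone_monoidMn ?(mu_cone G).
rewrite (monoid_point_sum (fun j _ => Kc j)).2.
split=> [/prodf_neq0 h j|h].
  rewrite inE negbK => /eqP z; have := h j isT.
  by rewrite monoid_pointMn ?(mu_cone G) // z expr0n; case: (c j =P 0%N) => //= _; rewrite eqxx.
apply/prodf_neq0 => j _; rewrite monoid_pointMn ?(mu_cone G) //.
case: (boolP (j \in support_face)) => [|/h ->]; last by rewrite expr0 oner_neq0.
by rewrite inE => z; rewrite expf_neq0.
Qed.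

(** The relation [\sum_(gamma_p > 0) gamma_p mu_p = \sum_(gamma_k < 0) |gamma_k| mu_k]:
    if the left side involves a vertex where the point vanishes, so does the
    right side. *)
Lemma support_face_face : is_face support_face.
Proof.
apply/andP; split; first by apply/set0Pn; exists i0; exact: (fintype.subsetP support_face_sub).
case: eqVneq => //= /eqP nT.
have rel : \sum_j (mu j - mu i0) *+ (if 0 < gamma j then `|gamma j|%N else 0%N) =
           \sum_j (mu j - mu i0) *+ (if gamma j < 0 then `|gamma j|%N else 0%N).
  apply/eqP; rewrite -subr_eq0 -sumrB.
  rewrite (eq_bigr (fun j => gamma j *: (mu j - mu i0))) => [|j _].
    under eq_bigr do rewrite scalerBr.
    rewrite sumrB -scaler_suml (gale_sum G) scale0r subr0; apply/eqP/colP => i.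
    rewrite summxE mxE -[RHS](gale_rel G i); apply: eq_bigr => j _.
    by rewrite !mxE mulrC.
  rewrite -!scaler_nat -scalerBl; congr (_ *: _).
  rewrite !natz; have := gale_neq0 G j.
  by case: ifP => h1; case: ifP => h2; lia.
have [j] : exists j, j \notin support_face.
  by apply/existsP; rewrite -negb_forall; apply: contra_notN nT => /forallP h; apply/setP => j; rewrite h inE.
move=> jI.
have pos_iff : (forall p, p \notin support_face -> ~~ (0 < gamma p)) <->
               (forall k, k \notin support_face -> ~~ (gamma k < 0)).
  have h1 := support_face_sum (fun j => if 0 < gamma j then `|gamma j|%N else 0%N).
  have h2 := support_face_sum (fun j => if gamma j < 0 then `|gamma j|%N else 0%N).
  rewrite rel in h1; split=> h.
    move=> k kI; have /h1/h2/(_ k kI) : forall p, p \notin support_face ->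
       (if 0 < gamma p then `|gamma p|%N else 0%N) = 0%N by move=> p /h; case: ifP.
    by case: ifP => //; lia.
  move=> k kI; have /h2/h1/(_ k kI) : forall p, p \notin support_face ->
       (if gamma p < 0 then `|gamma p|%N else 0%N) = 0%N by move=> p /h; case: ifP.
  by case: ifP => //; lia.
have ex (s : pred 'I_n) : ~ (forall p, p \notin support_face -> ~~ s p) ->
    exists2 p, p \notin support_face & s p.
  move=> no; case: (pickP [pred p | (p \notin support_face) && s p]) => [p /andP[]|nop].
    by exists p.
  by case: no => p pI; apply/negP => sp; have := nop p; rewrite /= pI sp.
have [gj|gj] : 0 < gamma j \/ gamma j < 0 by have := gale_neq0 G j; lia.
  have [|k kI gk] := ex (fun k => gamma k < 0).
    by move/pos_iff/(_ j jI); rewrite gj.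
  by apply/existsP; exists j; apply/existsP; exists k; apply/and4P.
have [|p pI gp] := ex (fun p => 0 < gamma p).
  by move/pos_iff/(_ j jI); rewrite gj.
by apply/existsP; exists p; apply/existsP; exists j; apply/and4P.
Qed.

(** Write [s D a] as a combination of the [mu j - mu i0] with coefficients [c j]
    that are non-negative off [K]; a large multiple of
    [\sum_(j in K) (mu j - mu i0)], where the point does not vanish, makes them
    all non-negative. *)
Lemma support_face_span a : phi a != 0 -> span_lattice support_face a.
Proof.
have [phi0 phiD phiZ] := phiP => phia.
have Ka : cone_monoid K a by apply: contraNT phia => /phiZ ->.
have [s [t [s0 c0]]] := cone_monoid_coef G Ka.
pose c j : int := s * nu N a j + t * gamma j.
have cmu : \sum_j c j *: (mu j - mu i0) = (s * D) *: a by exact: combination.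
pose T : nat := (\sum_j `|c j|)%N.
have cT j : 0 <= c j + T%:Z.
  suff : (`|c j|%N <= T)%N by lia.
  by rewrite /T (bigD1 j) //= leq_addr.
pose e j : nat := absz (c j + (if j \in K then T%:Z else 0)).
have eE j : (e j)%:Z = c j + (if j \in K then T%:Z else 0).
  by rewrite gez0_abs //; case: ifP => [_|/negbT/c0]; rewrite ?addr0.
pose sD := absz (s * D).
have sDE : sD%:Z = s * D by rewrite gez0_abs // mulr_ge0 ?ltW ?(splitting_gt0 G).
(* Evaluated at the point, this equates a product over the [j] with [e j > 0] to
   a non-zero value, so [e] vanishes off the support face. *)
have rel : \sum_j (mu j - mu i0) *+ e j =
    a *+ sD + \sum_j (mu j - mu i0) *+ (if j \in K then T else 0%N).
  transitivity ((s * D) *: a + \sum_j (mu j - mu i0) *+ (if j \in K then T else 0%N)).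
    rewrite -cmu -big_split; apply: eq_bigr => j _ /=.
    rewrite -!scaler_nat !natz eE -scalerDl; congr (_ *: _).
    by case: ifP.
  by rewrite -sDE -natz scaler_nat.
have Kb j : cone_monoid K ((mu j - mu i0) *+ (if j \in K then T else 0%N)).
  by rewrite cone_monoidMn ?(mu_cone G).
have [KB _] := monoid_point_sum (fun j (_ : true) => Kb j).
have e0 j : j \notin support_face -> c j = 0.
  move=> jI; have jK : j \notin K by apply: contra jI; exact: (fintype.subsetP support_face_sub).
  suff : e j = 0%N by have := eE j; rewrite (negbTE jK); lia.
  move: j jI {jK}; apply/support_face_sum; rewrite rel phiD ?cone_monoidMn //.
  rewrite mulf_neq0 ?monoid_pointMn ?expf_neq0 //; apply/support_face_sum => j jI.
  rewrite ifF //; apply: contraNF jI; exact: (fintype.subsetP support_face_sub).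
apply/span_latticeP => p k /and4P[_ _ pI kI].
have := e0 p pI; have := e0 k kI; rewrite /c /wall => ek ep.
apply: (mulfI (lt0r_neq0 s0)); rewrite mulr0.
transitivity ((s * nu N a k + t * gamma k) * gamma p - (s * nu N a p + t * gamma p) * gamma k).
  by ring.
by rewrite ek ep !mul0r subrr.
Qed.

End MonoidPoint.

(** An element of the relative interior of the cone that the [mu i - mu i0]
    span: the walls of facets that contain [i0] but not [I] are positive on it,
    so adding it often enough moves the lattice of [I] into smaller monoids. *)
Definition inner_sum I i0 : 'cV[int]_d := \sum_(i in I) (mu i - mu i0).

Lemma wall_inner_sum I i0 K p k : i0 \in K -> facet K p k ->
  wall p k (inner_sum I i0) = D * ((k \in I)%:Z * gamma p - (p \in I)%:Z * gamma k).
Proof.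
move=> i0K /and4P[gp gk pK kK]; rewrite wall_sum.
have ni l : l \notin K -> (i0 == l) = false by apply: contraNF => /eqP <-.
under eq_bigr => i _ do rewrite (wall_mu G) !ni // !subr0.
rewrite -mulr_sumr sumrB -!mulr_suml.
have cnt l : \sum_(i in I) (i == l)%:Z = (l \in I)%:Z.
  case: (boolP (l \in I)) => lI; last first.
    by rewrite big1 // => i iI; rewrite (_ : (i == l) = false) //; apply: contraNF lI => /eqP <-.
  by rewrite (bigD1 l) //= eqxx big1 ?addr0 // => i /andP[_ /negbTE ->].
by rewrite !cnt.
Qed.

Lemma inner_sum_span I i0 : i0 \in I -> span_lattice I (inner_sum I i0).
Proof.
move=> i0I; apply/span_latticeP => p k f; rewrite (wall_inner_sum I i0I f).
by have /and4P[_ _ /negbTE -> /negbTE ->] := f; rewrite !mul0r subrr mulr0.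
Qed.

Lemma inner_sum_cone I i0 K : i0 \in K -> cone_monoid K (inner_sum I i0).
Proof.
move=> i0K; apply/cone_monoidP => p k f; rewrite (wall_inner_sum I i0K f).
have /and4P[gp gk _ _] := f; have := splitting_gt0 G.
by case: (k \in I); case: (p \in I) => /=; nia.
Qed.

Lemma span_cone_inner_sum I i0 K a : i0 \in K -> span_lattice I a ->
  exists l, cone_monoid K (a + inner_sum I i0 *+ l).
Proof.
move=> i0K /span_latticeP Ia.
exists (\sum_p \sum_k `|wall p k a|)%N.
apply/cone_monoidP => p k f; rewrite wallD wallMn (wall_inner_sum I i0K f).
case: (boolP (facet I p k)) => fI.
  rewrite Ia // add0r; have /and4P[_ _ /negbTE -> /negbTE ->] := fI.
  by rewrite !mul0r subrr mulr0 mul0r.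
have /and4P[gp gk _ _] := f.
have big : (`|wall p k a| <= \sum_p \sum_k `|wall p k a|)%N.
  rewrite (bigD1 p) //=; apply: leq_trans (leq_addr _ _).
  by rewrite (bigD1 k) //= leq_addr.
have ge1 : 1 <= D * ((k \in I)%:Z * gamma p - (p \in I)%:Z * gamma k).
  have := splitting_gt0 G; move: fI; rewrite /facet gp gk /=.
  by case: (k \in I); case: (p \in I) => //= _; nia.
move: big ge1; set S := (\sum_p _)%N; set E := D * _ => big ge1.
have : S%:Z <= E * S%:Z by rewrite ler_peMl.
by move: big; set w := wall p k a; lia.
Qed.

(** The point does not vanish at [inner_sum], so it extends to the whole lattice
    of its support face by dividing by powers of that value. *)
Lemma orbit_point_exists K phi : K != finset.set0 -> monoid_point K phi ->
  exists I theta, [/\ is_face I, K \subset I, orbit_point I theta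
                    & forall a, cone_monoid K a -> phi a = theta a].
Proof.
move=> /set0Pn[i0 i0K] phiP; have [phi0 phiD phiZ] := phiP.
pose I := support_face phi i0.
have fI : is_face I by exact: support_face_face phiP _ i0K.
have KI : K \subset I by exact: support_face_sub phiP _ i0K.
have i0I : i0 \in I by exact: (fintype.subsetP KI).
pose b := inner_sum I i0.
have Kb : cone_monoid K b by exact: inner_sum_cone.
have phib : phi b != 0.
  have -> : b = \sum_j (mu j - mu i0) *+ (j \in I).
    rewrite /b /inner_sum big_mkcond; apply: eq_bigr => j _.
    by case: (j \in I).
  by apply/(support_face_sum phiP i0K) => j /negbTE ->.
have ex a : exists l, span_lattice I a -> cone_monoid K (a + b *+ l).
  case: (boolP (span_lattice I a)) => [/(span_cone_inner_sum i0K)[l]|_]; last by exists 0%N.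
  by exists l.
pose l a := projT1 (cid (ex a)).
have lP a : span_lattice I a -> cone_monoid K (a + b *+ l a) by rewrite /l; case: cid.
pose theta a := if span_lattice I a then phi (a + b *+ l a) / phi b ^+ l a else 0.
have indep a l1 : span_lattice I a -> cone_monoid K (a + b *+ l1) ->
    theta a = phi (a + b *+ l1) / phi b ^+ l1.
  move=> Ia K1; rewrite /theta Ia; apply/eqP.
  rewrite eqr_div ?expf_neq0 // -!(monoid_pointMn phiP) //.
  rewrite -!phiD ?cone_monoidMn ?lP //; apply/eqP; congr phi.
  by rewrite addrAC.
exists I, theta; split=> //.
  split.
  - by rewrite (@indep 0 0%N) ?span_lattice0 // ?mulr0n ?addr0 ?cone_monoid0 // expr0 divr1.
  - move=> a1 a2 I1 I2.
    have e : a1 + a2 + b *+ (l a1 + l a2) = (a1 + b *+ l a1) + (a2 + b *+ l a2).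
      by rewrite mulrnDr addrACA.
    have [K1 K2] := (lP _ I1, lP _ I2).
    have K12 : cone_monoid K (a1 + a2 + b *+ (l a1 + l a2)) by rewrite e cone_monoidD.
    rewrite (indep _ _ (span_latticeD I1 I2) K12) e (phiD _ _ K1 K2).
    by rewrite exprD invfM mulrACA /theta I1 I2.
  - by move=> a /negbTE Ia; rewrite /theta Ia.
move=> a Ka; case: (boolP (span_lattice I a)) => [Ia|Ia].
  by rewrite (@indep a 0%N) ?mulr0n ?addr0 // expr0 divr1.
rewrite /theta (negbTE Ia); apply/eqP; apply: contraNT Ia.
exact: support_face_span phiP _ i0K _.
Qed.

Lemma orbit_point_neq0 I theta a : orbit_point I theta ->
  (theta a != 0) = span_lattice I a.
Proof.
move=> [t0 tD tZ]; case: (boolP (span_lattice I a)) => [Ia|/tZ ->]; last by rewrite eqxx.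
apply: contra_eq_neq t0 => z; rewrite -(subrr a) tD ?span_latticeN // z mul0r.
by rewrite eq_sym oner_neq0.
Qed.

(** A chart sees which [mu j - mu i0] lie in the lattice, hence the face, and it
    sees the lattice up to multiples of [inner_sum], hence the point. *)
Lemma orbit_point_uniq K I theta I' theta' : K != finset.set0 ->
  is_face I -> K \subset I -> orbit_point I theta ->
  is_face I' -> K \subset I' -> orbit_point I' theta' ->
  (forall a, cone_monoid K a -> theta a = theta' a) -> I = I' /\ theta = theta'.
Proof.
move=> /set0Pn[i0 i0K] fI KI tI fI' KI' tI' e.
have i0I := fintype.subsetP KI _ i0K; have i0I' := fintype.subsetP KI' _ i0K.
have II' : I = I'.
  apply/setP => j; rewrite -(mu_span G j fI i0I) -(mu_span G j fI' i0I').
  by rewrite -(orbit_point_neq0 _ tI) -(orbit_point_neq0 _ tI') e ?(mu_cone G).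
split=> //; subst I'; apply/funext => a.
have [_ tD tZ] := tI; have [_ tD' tZ'] := tI'.
case: (boolP (span_lattice I a)) => [Ia|Ia]; last by rewrite tZ ?tZ'.
have [l Kl] := span_cone_inner_sum i0K Ia.
have Ib := inner_sum_span i0I; pose b := inner_sum I i0.
have Ibl : span_lattice I (b *+ l).
  by apply/span_latticeP => p k f; rewrite wallMn (span_latticeP _ _ _ _ Ib) ?mul0r.
have pow theta1 (t1P : orbit_point I theta1) : theta1 (b *+ l) = theta1 b ^+ l.
  have [t10 t1D _] := t1P; elim: (l) => [|l' IH]; first by rewrite mulr0n expr0.
  rewrite mulrS exprS t1D ?IH //.
  by apply/span_latticeP => p k f; rewrite wallMn (span_latticeP _ _ _ _ Ib) ?mul0r.
have nz : theta b ^+ l != 0 by rewrite expf_neq0 // (orbit_point_neq0 _ tI).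
apply: (mulIf nz); have := e _ Kl.
by rewrite tD // tD' // !pow // -(e b) ?inner_sum_cone.
Qed.

(** The point that an orbit point defines in the chart of [K], for [K] in [I]. *)
Definition chart_trace K theta a : F := if cone_monoid K a then theta a else 0.

Lemma chart_trace_monoid_point K I theta : K \subset I -> orbit_point I theta ->
  monoid_point K (chart_trace K theta).
Proof.
move=> KI tP; have [t0 tD tZ] := tP; split.
- by rewrite /chart_trace cone_monoid0.
- move=> a b Ka Kb; rewrite /chart_trace cone_monoidD // Ka Kb.
  case: (boolP (span_lattice I (a + b))); rewrite (span_lattice_face KI) //.
    by case/andP; exact: tD.
  move=> nab; rewrite tZ; last by rewrite (span_lattice_face KI).
  by move: nab; rewrite negb_and => /orP[/tZ ->|/tZ ->]; rewrite ?mul0r ?mulr0.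
- by move=> a /negbTE Ka; rewrite /chart_trace Ka.
Qed.

End Orbits.

(** * Gluing and closure *)

Section Closure.
Variables (d n : nat) (m : 'M[int]_(d, n)) (gamma : 'I_n -> int).
Variables (D : int) (N : 'M[int]_(n, d)).
Hypothesis G : gale_splitting m gamma D N.
Variables (R : realType) (F : fieldType).
Implicit Types (a b : 'cV[int]_d) (K I : {set 'I_n}) (i j k p : 'I_n).
Implicit Types (phi theta : 'cV[int]_d -> F) (x y : set 'cV[R]_d * ('cV[int]_d -> F)).
Local Notation mu j := (col j m).
Local Notation wall := (wall gamma N).
Local Notation is_face := (is_face gamma).
Local Notation cone_monoid := (cone_monoid gamma N).
Local Notation monoid_point := (monoid_point gamma N).
Local Notation orbit_point := (orbit_point gamma N).
Local Notation chart_trace := (chart_trace gamma N).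
Local Notation P := (newton_polytope R m).
Local Notation cone := (@cone d n m R).

Lemma chart_points_cone K phi : K != finset.set0 ->
  chart_points (cone K) phi <-> monoid_point K phi.
Proof.
move=> K0; have S a := dual_monoid_cone G R a K0.
split=> -[phi0 phiD phiZ]; split=> //.
- by move=> a b /S Ka /S Kb; exact: phiD.
- by move=> a Ka; apply: phiZ => /S; apply/negP.
- by move=> a b /S Ka /S Kb; exact: phiD.
- by move=> a nKa; apply: phiZ; apply/negP => /S.
Qed.

(** The local points on the orbit of [I] that represent the orbit point. [K] need
    not be a face, see [cone]. *)
Definition traces I theta x : Prop := exists K,
  [/\ K != finset.set0, K \subset I, x.1 = cone K & x.2 = chart_trace K theta].

Lemma local_points_traces x : (0 < n)%N -> local_points P x ->
  exists I theta, [/\ is_face I, orbit_point I theta & traces I theta x].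
Proof.
case: x => [s phi] n0 [[y /= ->]]; rewrite normal_cone_face //.
have K0 := argmin_neq0 m y n0; set K := argmin m y in K0 *.
move=> /(chart_points_cone _ K0) phiP.
have [I [theta [fI KI tP e]]] := orbit_point_exists G K0 phiP.
exists I, theta; split=> //; exists K; split=> //=.
apply/funext => a; rewrite /chart_trace; case: ifPn => [/e //|].
by have [_ _ phiZ] := phiP; exact: phiZ.
Qed.

Lemma orbit_point_local I theta : is_face I -> orbit_point I theta ->
  local_points P (cone I, theta) /\ traces I theta (cone I, theta).
Proof.
move=> fI tP; have /andP[I0 _] := fI.
have e : theta = chart_trace I theta.
  apply/funext => a; rewrite /chart_trace; case: ifPn => // nIa.
  by have [_ _ ->] := tP => //; apply: contra nIa; exact: span_lattice_cone.
split; last by exists I.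
split; first exact: (normal_fan_face G).
by apply/chart_points_cone => //=; rewrite e; exact: chart_trace_monoid_point tP.
Qed.

(** The gluing chart is that of [K :|: K'], which still lies in [I]. *)
Lemma traces_glued I theta x y : orbit_point I theta ->
  traces I theta x -> traces I theta y -> glued x y.
Proof.
move=> tP [K [K0 KI xK xt]] [K' [K'0 K'I yK yt]].
have KK'0 : K :|: K' != finset.set0.
  by have /set0Pn[i iK] := K0; apply/set0Pn; exists i; rewrite inE iK.
exists (chart_trace (K :|: K') theta); rewrite xK yK coneU; split.
- by apply/chart_points_cone => //; apply: chart_trace_monoid_point tP; rewrite finset.subUset KI.
- move=> a /(dual_monoid_cone G R a K0) Ka.
  by rewrite xt /chart_trace Ka (cone_monoid_sub _ Ka) ?finset.subsetUl.
- move=> a /(dual_monoid_cone G R a K'0) Ka.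
  by rewrite yt /chart_trace Ka (cone_monoid_sub _ Ka) ?finset.subsetUr.
Qed.

(** A point of the intersection chart belongs to some orbit, and by uniqueness
    this orbit and the point on it are those of both traces. *)
Lemma glued_traces I theta I' theta' x y :
  is_face I -> orbit_point I theta -> traces I theta x ->
  is_face I' -> orbit_point I' theta' -> traces I' theta' y ->
  glued x y -> I = I' /\ theta = theta'.
Proof.
move=> fI tP [K [K0 KI xK xt]] fI' tP' [K' [K'0 K'I yK yt]] [phi []].
rewrite xK yK coneU.
have KK'0 : K :|: K' != finset.set0.
  by have /set0Pn[i iK] := K0; apply/set0Pn; exists i; rewrite inE iK.
move=> /(chart_points_cone _ KK'0)/(orbit_point_exists G KK'0).
move=> [J [eta [fJ KJ eP e]]] px py.
have KsJ := fintype.subset_trans (finset.subsetUl K K') KJ.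
have K'sJ := fintype.subset_trans (finset.subsetUr K K') KJ.
have [-> ->] : I = J /\ theta = eta.
  apply: (orbit_point_uniq G K0) => // a Ka.
  rewrite -e ?(cone_monoid_sub _ Ka) ?finset.subsetUl // px; last exact/(dual_monoid_cone G R a K0).
  by rewrite xt /chart_trace Ka.
suff [-> ->] : I' = J /\ theta' = eta by [].
apply: (orbit_point_uniq G K'0) => // a Ka.
rewrite -e ?(cone_monoid_sub _ Ka) ?finset.subsetUr // py; last exact/(dual_monoid_cone G R a K'0).
by rewrite yt /chart_trace Ka.
Qed.

Section Hypersurface.
Variable u : 'I_n -> F.
Hypothesis u_neq0 : forall j, u j != 0.
Hypothesis mu_inj : injective (fun j => mu j).
Local Notation g := (laurent_of m u).

Lemma fsum_seq (T : choiceType) (s : seq T) (h : T -> F) : uniq s ->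
  (forall t, t \notin s -> h t = 0) -> \sum_(t \in [set: T]) h t = \sum_(t <- s) h t.
Proof.
move=> us hs; rewrite (fsbigE s) //; last by move=> a _; exact: hs.
by rewrite big_mkcond; apply: eq_bigr => a _; rewrite in_setT.
Qed.

Lemma laurent_mulE h a : laurent_mul g h a = \sum_j u j * h (a - mu j).
Proof.
rewrite /laurent_mul (@fsum_seq _ [seq mu j | j <- enum 'I_n]).
- rewrite big_map big_enum; apply: eq_bigr => j _; congr (_ * _).
  rewrite /laurent_of (bigD1 j) //= big1 ?addr0 // => i /andP[/eqP/mu_inj -> ].
  by rewrite eqxx.
- by rewrite map_inj_uniq ?enum_uniq.
move=> b nb; rewrite [g b]big1 ?mul0r // => j /eqP ej; move: nb.
by rewrite -ej; case/negP; apply/mapP; exists j; rewrite ?mem_enum.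
Qed.

(** Evaluation of [g h] at a point of a chart, regrouped by the terms of [h]. *)
Lemma laurent_pairing h (s : seq 'cV[int]_d) phi : uniq s ->
  (forall a, a \notin s -> h a = 0) ->
  \sum_(a \in [set: 'cV[int]_d]) laurent_mul g h a * phi a =
  \sum_(b <- s) h b * \sum_j u j * phi (mu j + b).
Proof.
move=> us hs.
pose r := undup (flatten [seq [seq mu j + b | b <- s] | j <- enum 'I_n]).
have rP j b : b \in s -> mu j + b \in r.
  move=> bs; rewrite mem_undup; apply/flattenP.
  exists [seq mu j + b | b <- s]; last exact: map_f.
  by apply/mapP; exists j; rewrite ?mem_enum.
have off j a : a \notin r -> h (a - mu j) = 0.
  move=> ar; apply: hs; apply: contra ar => /(rP j).
  by rewrite addrC subrK.
rewrite (@fsum_seq _ r) ?undup_uniq //; last first.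
  by move=> a ar; rewrite laurent_mulE big1 ?mul0r // => j _; rewrite off ?mulr0.
under eq_bigr do rewrite laurent_mulE mulr_suml.
under [RHS]eq_bigr do rewrite mulr_sumr.
rewrite exchange_big [RHS]exchange_big; apply: eq_bigr => j _ /=.
rewrite -(@fsum_seq _ r (fun a => u j * h (a - mu j) * phi a)) ?undup_uniq //; last first.
  by move=> a /(off j) ->; rewrite mulr0 mul0r.
rewrite (@fsum_seq _ [seq mu j + b | b <- s]).
- rewrite big_map; apply: eq_bigr => b _.
  by rewrite addrAC subrr add0r mulrCA mulrA.
- by rewrite map_inj_uniq //; exact: addrI.
move=> a na; rewrite hs ?mulr0 ?mul0r //; apply: contra na => h1.
by apply/mapP; exists (a - mu j) => //; rewrite addrC subrK.
Qed.

Lemma seq_argmin (T : eqType) (s : seq T) (f : T -> int) t0 : t0 \in s ->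
  exists2 t, t \in s & {in s, forall t', f t <= f t'}.
Proof.
elim: s t0 => // t1 [|t2 s] IH t0 _.
  by exists t1 => [|t]; rewrite inE // => /eqP ->.
have [t ts tmin] := IH t2 (mem_head _ _).
case: (lerP (f t1) (f t)) => le1.
  exists t1 => [|t']; first exact: mem_head.
  by rewrite in_cons => /predU1P[-> //|/tmin]; exact: le_trans.
exists t => [|t']; first by rewrite in_cons ts orbT.
by rewrite in_cons => /predU1P[->|/tmin //]; exact: ltW.
Qed.

(** A product [g h] supported in the monoid forces [h] to be supported in the
    translated monoid: the lowest terms of [g] and [h] for a wall do not cancel.
    Among the sums of two lowest exponents, one of maximal Euclidean norm is
    attained once only, by the parallelogram law. *)
Lemma laurent_mul_support h K i0 : i0 \in K ->
  finite_set [set a | h a != 0] ->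
  (forall a, laurent_mul g h a != 0 -> cone_monoid K a) ->
  forall b, h b != 0 -> cone_monoid K (mu i0 + b).
Proof.
move=> i0K /finite_seqP[s hS] supp b hb; apply/cone_monoidP => p k f.
have sP a : (a \in s) = (h a != 0).
  have e : (h a != 0) = ([set` s] a) :> Prop by rewrite -hS.
  by apply/idP/idP; rewrite e.
have [b1 b1s b1min] : exists2 b1, b1 \in s & {in s, forall a, wall p k b1 <= wall p k a}.
  by apply: (@seq_argmin _ s _ b); rewrite sP.
have mu_min j : wall p k (mu i0) <= wall p k (mu j).
  by have /cone_monoidP/(_ p k f) := mu_cone G j i0K; rewrite wallD wallN subr_ge0.
(* The pairs of a lowest term of [g] and a lowest term of [h]. *)
pose low := [seq jb <- [seq (j, a) | j <- enum 'I_n, a <- s] |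
    (wall p k (mu jb.1) == wall p k (mu i0)) && (wall p k jb.2 == wall p k b1)].
have lowP j a : ((j, a) \in low) =
    [&& wall p k (mu j) == wall p k (mu i0), wall p k a == wall p k b1 & a \in s].
  rewrite mem_filter /= andbA; congr (_ && _); apply/allpairsP/idP => [[[j' a'] /= []]|as_].
    by move=> _ ? [_ ->].
  by exists (j, a); rewrite /= mem_enum.
(* Maximal Euclidean norm: [seq_argmin] applied to the opposite. *)
pose sq (a : 'cV[int]_d) : int := \sum_i a i 0 ^+ 2.
have [[j0 b0] low0 max0] : exists2 jb, jb \in low &
    {in low, forall jb', - sq (mu jb.1 + jb.2) <= - sq (mu jb'.1 + jb'.2)}.
  by apply: (@seq_argmin _ low _ (i0, b1)); rewrite lowP !eqxx.
move: (low0); rewrite lowP => /and3P[/eqP wj0 /eqP wb0 b0s].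
have : laurent_mul g h (mu j0 + b0) != 0.
  rewrite laurent_mulE (bigD1 j0) //= big1 => [|j jj0]; last first.
    pose b' := mu j0 + b0 - mu j.
    have [->|hb'] := eqVneq (h b') 0; first by rewrite mulr0.
    have b's : b' \in s by rewrite sP.
    have wb' : wall p k b' = wall p k b0 + wall p k (mu j0) - wall p k (mu j).
      by rewrite /b' !wallD wallN [wall p k b0 + _]addrC.
    have [wj wb] : wall p k (mu j) = wall p k (mu i0) /\ wall p k b' = wall p k b1.
      by have := b1min _ b's; have := mu_min j; rewrite wb'; lia.
    have := max0 (j, b0); have := max0 (j0, b').
    rewrite !lowP wj wj0 wb wb0 !eqxx b's b0s !lerN2 => /(_ isT) /= l1 /(_ isT) /= l2.
    (* [mu j + b0] and [mu j0 + b'] are symmetric about [mu j0 + b0], and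
       their difference to it is [mu j - mu j0] up to sign. *)
    have : \sum_i (mu j i 0 - mu j0 i 0) ^+ 2 <= 0.
      suff : (\sum_i (mu j i 0 - mu j0 i 0) ^+ 2) *+ 2 =
         sq (mu j + b0) + sq (mu j0 + b') - sq (mu j0 + b0) *+ 2 by lia.
      rewrite /sq -!sumrMnl -big_split -sumrB; apply: eq_bigr => i _.
      by rewrite !mxE /=; ring.
    have ge0 : 0 <= \sum_i (mu j i 0 - mu j0 i 0) ^+ 2.
      by apply: sumr_ge0 => i _; exact: sqr_ge0.
    move=> le0; have /eqP : \sum_i (mu j i 0 - mu j0 i 0) ^+ 2 = 0 by lia.
    rewrite psumr_eq0 => [/allP sq0|i _]; last exact: sqr_ge0.
    case/negP: jj0; apply/eqP/mu_inj/colP => i.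
    have := sq0 i; rewrite mem_index_enum sqrf_eq0 subr_eq0 => /(_ isT)/eqP.
    by [].
  by rewrite addr0 [mu j0 + b0]addrC addrK mulf_neq0 // -sP.
move=> /supp/cone_monoidP/(_ p k f); rewrite !wallD wj0 wb0 => /le_trans; apply.
by rewrite lerD2l b1min // sP.
Qed.

Definition orbit_equation I theta : Prop :=
  forall i, i \in I -> \sum_(j in I) u j * theta (mu j - mu i) = 0.

(** Changing the base vertex multiplies the equation by a unit. *)
Lemma orbit_equation_at I theta i : is_face I -> orbit_point I theta -> i \in I ->
  \sum_(j in I) u j * theta (mu j - mu i) = 0 -> orbit_equation I theta.
Proof.
move=> fI [_ tD _] iI e i' i'I.
transitivity (theta (mu i - mu i') * \sum_(j in I) u j * theta (mu j - mu i)); last first.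
  by rewrite e mulr0.
rewrite mulr_sumr; apply: eq_bigr => j jI; rewrite mulrCA -tD ?(mu_span G) //.
by congr (_ * theta _); rewrite [in RHS]addrC subrKA.
Qed.

(** The element [g] times the inverse of a vertex monomial of [K] lies in the
    coordinate ring of the chart, and by [laurent_mul_support] it generates the
    whole ideal of the closure. *)
Lemma on_closureE I theta x : is_face I -> orbit_point I theta ->
  traces I theta x -> on_closure g x <-> orbit_equation I theta.
Proof.
move=> fI tP [K [K0 KI xK xt]].
have /set0Pn[i0 i0K] := K0; have i0I := fintype.subsetP KI _ i0K.
have S a := dual_monoid_cone G R a K0.
have phiP : monoid_point K x.2 by rewrite xt; exact: chart_trace_monoid_point tP.
have eqE : \sum_j u j * x.2 (mu j - mu i0) = \sum_(j in I) u j * theta (mu j - mu i0).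
  rewrite [RHS]big_mkcond; apply: eq_bigr => j _.
  rewrite xt /chart_trace (mu_cone G) //; case: ifP => // jI.
  have [_ _ ->] := tP; first by rewrite mulr0.
  by rewrite (mu_span G) // jI.
split=> [cl|e].
  apply: (orbit_equation_at fI tP i0I); rewrite -eqE.
  pose h a : F := (a == - mu i0)%:R.
  have hs a : a \notin [:: - mu i0] -> h a = 0 by rewrite inE /h => /negbTE ->.
  have := cl h; rewrite (@laurent_pairing h [:: - mu i0]) // big_seq1 /h eqxx mul1r.
  apply.
    apply: (@sub_finite_set _ _ [set - mu i0]) => [a /=|]; last exact: finite_set1.
    by apply: contra_neqP => /eqP/negbTE ->.
  move=> a; rewrite laurent_mulE xK => nz; apply/S; apply: contraNT nz => nKa.
  rewrite big1 // => j _; rewrite /h; case: eqP => [e|]; last by rewrite mulr0.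
  case/negP: nKa; have -> : a = mu j - mu i0 by rewrite -e addrC subrK.
  exact: (mu_cone G).
move=> h hfin hsupp.
have [s hS] := (finite_seqP _).1 hfin.
have {}hsupp a : laurent_mul g h a != 0 -> cone_monoid K a.
  by move=> /hsupp; rewrite xK => /S.
rewrite (@laurent_pairing h (undup s)) ?undup_uniq //; last first.
  move=> a; rewrite mem_undup => as_; apply/eqP; apply: contraNT as_ => ha.
  by have : [set` s] a by rewrite -hS.
rewrite big1 // => b _; have [->|hb] := eqVneq (h b) 0; first by rewrite mul0r.
have Kb := laurent_mul_support i0K hfin hsupp hb.
have -> : \sum_j u j * x.2 (mu j + b) =
    x.2 (mu i0 + b) * \sum_j u j * x.2 (mu j - mu i0).
  have [_ phiD _] := phiP; rewrite mulr_sumr; apply: eq_bigr => j _.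
  rewrite mulrCA -phiD ?(mu_cone G) //; congr (_ * x.2 _).
  by rewrite [RHS]addrC addrA subrK.
by rewrite eqE e ?mulr0.
Qed.

Definition orbit_class I theta : set (set 'cV[R]_d * ('cV[int]_d -> F)) :=
  [set y | local_points P y /\ glued (cone I, theta) y].

Lemma orbit_class_inj I theta I' theta' :
  is_face I -> orbit_point I theta -> is_face I' -> orbit_point I' theta' ->
  orbit_class I theta = orbit_class I' theta' -> I = I' /\ theta = theta'.
Proof.
move=> fI tP fI' tP' e.
have [_ can] := orbit_point_local fI tP.
have [loc2 can2] := orbit_point_local fI' tP'.
have : orbit_class I theta (cone I', theta').
  by rewrite e; split=> //; exact: (traces_glued tP' can2 can2).
by move=> [_]; apply: glued_traces can _ _ can2.
Qed.

(** The toric variety is the disjoint union of its orbits, and the closure meets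
    each of them in the zero locus of the truncation of [g] to the face. *)
Lemma closure_pointsE C : (0 < n)%N -> closure_points P g C <->
  exists I theta, [/\ is_face I, orbit_point I theta, orbit_equation I theta
                    & C = orbit_class I theta].
Proof.
move=> n0; split.
  move=> [[x locx ->] [y [locy gl] cl]].
  have [I [theta [fI tP tr]]] := local_points_traces n0 locx.
  have [J [eta [fJ eP etr]]] := local_points_traces n0 locy.
  have [eI et] := glued_traces fI tP tr fJ eP etr gl; subst J eta.
  exists I, theta; split=> //; first exact/(on_closureE fI tP etr).
  have [loc can] := orbit_point_local fI tP.
  apply/seteqP; split=> z [locz glz]; split=> //.
    have [J [eta [fJ' eP' ztr]]] := local_points_traces n0 locz.
    have [eI et] := glued_traces fI tP tr fJ' eP' ztr glz; subst J eta.
    exact: traces_glued tP can ztr.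
  have [J [eta [fJ' eP' ztr]]] := local_points_traces n0 locz.
  have [eI et] := glued_traces fI tP can fJ' eP' ztr glz; subst J eta.
  exact: traces_glued tP tr ztr.
move=> [I [theta [fI tP eq ->]]].
have [loc can] := orbit_point_local fI tP.
split; first by exists (cone I, theta).
exists (cone I, theta); first by split=> //; exact: (traces_glued tP can can).
exact/(on_closureE fI tP can).
Qed.

End Hypersurface.
End Closure.

(** * Bases of the lattices of faces *)

Section FaceLattice.
Variables (d n : nat) (m : 'M[int]_(d, n)) (gamma : 'I_n -> int).
Variables (D : int) (N : 'M[int]_(n, d)).
Hypothesis G : gale_splitting m gamma D N.
Implicit Types (a b : 'cV[int]_d) (K I : {set 'I_n}) (i j k p : 'I_n).
Local Notation mu j := (col j m).
Local Notation is_face := (is_face gamma).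
Local Notation span_lattice := (span_lattice gamma N).

Definition face_dim I : nat := if I == [set: 'I_n]%SET then d else #|I|.-1.

Lemma span_lattice_divide I a (t : int) : t != 0 ->
  span_lattice I (t *: a) = span_lattice I a.
Proof.
move=> t0; apply/span_latticeP/span_latticeP => h p k f; have := h p k f; rewrite wallZ.
  by move/eqP; rewrite mulf_eq0 (negbTE t0) => /eqP.
by move=> ->; rewrite mulr0.
Qed.

(** Where the walls vanish, the coefficients of [cone_monoid_coef] have to be 0
    off the face, being non-negative. *)
Lemma span_lattice_coef I i0 a : is_face I -> I != [set: 'I_n]%SET -> i0 \in I ->
  span_lattice I a -> exists (t : int) (c : 'I_n -> int),
  t != 0 /\ t *: a = \sum_(j in I) c j *: (mu j - mu i0).
Proof.
move=> /andP[_ /orP[/eqP ->|/existsP[p0 /existsP[k0 f0]]]]; first by rewrite eqxx.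
move=> _ i0I Ia; have [s [t [s0 c0]]] := cone_monoid_coef G (span_lattice_cone Ia).
have [gp0 gk0 p0I k0I] := and4P f0.
pose c j := s * nu N a j + t * gamma j.
have c_eq p k : facet gamma I p k -> c p = 0 /\ c k = 0.
  move=> f; have [gp gk pI kI] := and4P f.
  have := c0 p pI; have := c0 k kI; rewrite -/(c p) -/(c k) => ck cp.
  have : c k * gamma p - c p * gamma k = 0.
    rewrite -(mulr0 s) -(span_latticeP _ _ _ _ Ia p k f) /wall /c; ring.
  nia.
have coff j : j \notin I -> c j = 0.
  move=> jI; have [gj|gj] : 0 < gamma j \/ gamma j < 0 by have := gale_neq0 G j; lia.
    by have [] := c_eq j k0; first exact/and4P.
  by have [] := c_eq p0 j; first exact/and4P.
exists (s * D), c; split; first by rewrite mulf_neq0 ?lt0r_neq0 ?(splitting_gt0 G).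
rewrite -(combination G s t a i0) [RHS]big_mkcond; apply: eq_bigr => j _.
by case: ifPn => // jI; rewrite -/(c j) coff ?scale0r.
Qed.

Section Smith.
Variables (I : {set 'I_n}) (i0 : 'I_n).
Hypotheses (fI : is_face I) (nT : I != [set: 'I_n]%SET) (i0I : i0 \in I).
Local Notation J := (I :\ i0)%SET.
Local Notation r := #|J|.

Definition edge_matrix : 'M[int]_(d, r) :=
  \matrix_(i, j) (mu (enum_val j) - mu i0) i 0.

Lemma edge_matrix_mul (v : 'cV[int]_r) :
  edge_matrix *m v = \sum_j v j 0 *: (mu (enum_val j) - mu i0).
Proof.
apply/colP => i; rewrite mxE summxE; apply: eq_bigr => j _.
by rewrite !mxE mulrC.
Qed.

(** The vertices of a proper face are affinely independent: an affine relation
    is a multiple of [gamma], which has no zero component. *)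
Lemma edge_matrix_free (v : 'cV[int]_r) : edge_matrix *m v = 0 -> v = 0.
Proof.
move=> Bv; pose w : 'cV[int]_n := \sum_j v j 0 *: (delta_mx (enum_val j) 0 - delta_mx i0 0).
have mw : m *m w = 0.
  rewrite -Bv edge_matrix_mul mulmx_sumr; apply: eq_bigr => j _.
  by rewrite -scalemxAr mulmxBr -!colE.
have sd (l : 'I_n) : \sum_i (delta_mx l 0 : 'cV[int]_n) i 0 = 1.
  rewrite (bigD1 l) //= big1 ?addr0 ?mxE ?eqxx // => i /negbTE il.
  by rewrite mxE il.
have w1 : \sum_i w i 0 = 0.
  under eq_bigr do rewrite summxE.
  rewrite exchange_big big1 // => j _ /=.
  have entry i : (v j 0 *: (delta_mx (enum_val j) 0 - delta_mx i0 0) : 'cV[int]_n) i 0 =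
      v j 0 * ((delta_mx (enum_val j) 0 : 'cV[int]_n) i 0 - (delta_mx i0 0 : 'cV[int]_n) i 0).
    by rewrite !mxE.
  by rewrite (eq_bigr _ (fun i _ => entry i)) -mulr_sumr sumrB !sd subrr mulr0.
have wE l : w l 0 = \sum_j v j 0 * ((l == enum_val j)%:Z - (l == i0)%:Z).
  by rewrite summxE; apply: eq_bigr => j _; rewrite !mxE !andbT !natz.
have [l lI] : exists l, l \notin I.
  apply/existsP; rewrite -negb_forall; apply: contra nT => /forallP h.
  by apply/eqP/setP => j; rewrite h inE.
have wl : w l 0 = 0.
  rewrite wE big1 // => j _.
  have := enum_valP j; rewrite !inE => /andP[_ jI].
  rewrite (_ : (l == enum_val j) = false); last by apply: contraNF lI => /eqP ->.
  by rewrite (_ : (l == i0) = false) ?subrr ?mulr0 //; apply: contraNF lI => /eqP ->.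
apply/colP => j; rewrite mxE.
have := relation_gale G mw w1 (enum_val j) l; rewrite wl mul0r.
move/eqP; rewrite mulf_eq0 (negbTE (gale_neq0 G l)) orbF wE => /eqP.
rewrite (bigD1 j) //= eqxx big1 ?addr0 => [|j' j'j].
  have := enum_valP j; rewrite !inE => /andP[/negbTE -> _].
  by rewrite subr0 mulr1.
rewrite (inj_eq enum_val_inj) eq_sym (negbTE j'j).
have := enum_valP j; rewrite !inE => /andP[/negbTE -> _].
by rewrite subrr mulr0.
Qed.

Lemma edge_matrix_span (v : 'cV[int]_r) : span_lattice I (edge_matrix *m v).
Proof.
rewrite edge_matrix_mul; apply: (big_ind (fun a => span_lattice I a)) => [||j _].
  exact: span_lattice0.
  exact: span_latticeD.
have [->|v0] := eqVneq (v j 0) 0; first by rewrite scale0r span_lattice0.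
by rewrite span_lattice_divide // (mu_span G) //; have := enum_valP j; rewrite !inE => /andP[].
Qed.

Lemma span_lattice_edge a : span_lattice I a ->
  exists (t : int) (v : 'cV[int]_r), t != 0 /\ t *: a = edge_matrix *m v.
Proof.
move=> Ia; have [t [c [t0 e]]] := span_lattice_coef fI nT i0I Ia.
exists t, (\col_j c (enum_val j)); split=> //; rewrite e edge_matrix_mul.
rewrite (bigD1 i0) //= subrr scaler0 add0r.
under [RHS]eq_bigr do rewrite mxE.
rewrite -(big_enum_val (A := mem J) (fun j => c j *: (mu j - mu i0))).
by apply: eq_bigl => j; rewrite !inE andbC.
Qed.

(** In the Smith normal form [L Dg S] of the edge matrix the diagonal has no zero
    by [edge_matrix_free], so [L^-1] maps the saturation of the column lattice
    onto the vectors whose coordinates from [r] on vanish. *)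
Lemma smith_basis : exists P : 'M[int]_d, [/\ P \in unitmx, (r <= d)%N &
  forall a, span_lattice I a <-> forall i : 'I_d, (r <= i)%N -> (P *m a) i 0 = 0].
Proof.
have [L uL [S uS [e _ eB]]] := int_Smith_normal_form edge_matrix.
pose Dg : 'M[int]_(d, r) := \matrix_(i, j) (e`_i *+ (i == j :> nat)).
have inj (w : 'cV[int]_r) : Dg *m w = 0 -> w = 0.
  move=> Dw; have : edge_matrix *m (invmx S *m w) = 0.
    by rewrite eB -mulmxA mulKVmx // -mulmxA Dw mulmx0.
  by move=> /edge_matrix_free z; rewrite -[w](mulKVmx uS) z mulmx0.
have diag (j : 'I_r) : (j < d)%N /\ e`_j != 0.
  suff : ~~ [forall i : 'I_d, Dg i j == 0].
    case/forallPn => i; rewrite mxE mulrb; case: (i =P j :> nat) => [<- e0|_]; last by rewrite eqxx.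
    by split.
  apply/negP => /forallP z; have : Dg *m (delta_mx j 0 : 'cV[int]_r) = 0.
    by rewrite -colE; apply/colP => i; rewrite mxE [RHS]mxE; apply/eqP.
  by move/inj/colP/(_ j)/eqP; rewrite !mxE !eqxx.
have rd : (r <= d)%N.
  by rewrite leqNgt; apply/negP => dr; have [] := diag (Ordinal dr); rewrite ltnn.
exists (invmx L); split=> // [|a]; first by rewrite unitmx_inv.
have low (w : 'cV[int]_r) (i : 'I_d) : (r <= i)%N -> (Dg *m w) i 0 = 0.
  move=> ri; rewrite mxE big1 // => j _; rewrite mxE.
  by rewrite (_ : (i == j :> nat) = false) ?mulrb ?mul0r // gtn_eqF // (leq_trans _ ri).
split=> [Ia i ri|z].
  have [t [v [t0 ta]]] := span_lattice_edge Ia.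
  have : (invmx L *m (t *: a)) i 0 = 0.
    by rewrite ta eB -!mulmxA mulKmx // low.
  rewrite -scalemxAr mxE => /eqP; rewrite mulf_eq0 (negbTE t0) => /eqP.
  by [].
pose del := \prod_(j < r) e`_j.
have del0 : del != 0 by apply/prodf_neq0 => j _; have [] := diag j.
pose w : 'cV[int]_r := \col_j (\prod_(l < r | l != j) e`_l * (invmx L *m a) (widen_ord rd j) 0).
have Dw : Dg *m w = del *: (invmx L *m a).
  apply/colP => i; rewrite [RHS]mxE.
  case: (leqP r i) => ri; first by rewrite low // z // mulr0.
  pose j := Ordinal ri; rewrite mxE (bigD1 j) //= big1 ?addr0 => [|l lj].
    rewrite [Dg i j]mxE eqxx mulrb [w j 0]mxE mulrA; congr (_ * _).
      by rewrite /del [RHS](bigD1 j).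
    by congr ((invmx L *m a) _ 0); apply/val_inj.
  rewrite mxE (_ : (i == l :> nat) = false) ?mulrb ?mul0r //.
  by apply: contraNF lj => /eqP il; apply/eqP/val_inj.
rewrite -(span_lattice_divide I a del0) -(mulKVmx uL (del *: a)) -scalemxAr -Dw.
have -> : L *m (Dg *m w) = edge_matrix *m (invmx S *m w).
  by rewrite eB -!mulmxA mulKVmx.
exact: edge_matrix_span.
Qed.

End Smith.

(** In the coordinates [P] the torus of the face consists of the first
    [face_dim I] factors. *)
Lemma span_lattice_basis I : is_face I -> exists P : 'M[int]_d,
  [/\ P \in unitmx, (face_dim I <= d)%N &
  forall a, span_lattice I a <-> forall i : 'I_d, (face_dim I <= i)%N -> (P *m a) i 0 = 0].
Proof.
move=> fI; rewrite /face_dim; case: eqVneq => [->|nT].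
  exists 1%:M; split=> // [|a]; first exact: unitmx1.
  split=> [_ i|_]; first by rewrite leqNgt ltn_ord.
  by apply/span_latticeP => p k /and4P[_ _]; rewrite inE.
have /andP[/set0Pn[i0 i0I] _] := fI.
have [P [uP rd PP]] := smith_basis fI nT i0I.
have e : #|I|.-1 = #|(I :\ i0)%SET| by rewrite (cardsD1 i0 I) i0I.
by exists P; rewrite e.
Qed.

End FaceLattice.

(** * Counting in one orbit *)

Section OrbitCount.
Variables (d n : nat) (m : 'M[int]_(d, n)) (gamma : 'I_n -> int).
Variables (D : int) (N : 'M[int]_(n, d)).
Hypothesis G : gale_splitting m gamma D N.
Variables (R : realType) (F : finFieldType) (psi chi : F -> R[i]).
Hypothesis psiP : nontrivial_additive_character psi.
Hypothesis chiP : multiplicative_character chi.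
Hypothesis chi_order : character_order chi #|F|.-1.
Variable u : 'I_n -> F.
Hypothesis u_neq0 : forall j, u j != 0.
Implicit Types (a b : 'cV[int]_d) (K I : {set 'I_n}) (i j k p : 'I_n).
Implicit Types (phi theta : 'cV[int]_d -> F).
Local Notation q := #|F|.
Local Notation Q := #|F|.-1.
Local Notation mu j := (col j m).
Local Notation is_face := (is_face gamma).
Local Notation span_lattice := (span_lattice gamma N).
Local Notation orbit_point := (orbit_point gamma N).
Local Notation face_dim := (@face_dim d n).

Lemma orbit_pointZ I theta (t : int) a : orbit_point I theta -> span_lattice I a ->
  theta (t *: a) = theta a ^ t.
Proof.
move=> tP Ia; have [t0 tD _] := tP.
have IZ (s : int) : span_lattice I (s *: a).
  have [->|s0] := eqVneq s 0; first by rewrite scale0r span_lattice0.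
  by rewrite span_lattice_divide.
have nat (l : nat) : theta (l%:Z *: a) = theta a ^+ l.
  elim: l => [|l IH]; first by rewrite scale0r.
  by rewrite intS scalerDl scale1r tD ?IH ?exprS.
case: t => l; first exact: nat.
rewrite NegzE -exprnN scaleNr; apply: (mulfI (x := theta (l.+1%:Z *: a))).
  by rewrite (orbit_point_neq0 _ tP).
rewrite -tD ?span_latticeN // subrr t0 nat mulfV // expf_neq0 //.
by rewrite (orbit_point_neq0 _ tP).
Qed.

Lemma orbit_point_lincomb I theta (J : finType) (s : pred J) (t : J -> int)
    (h : J -> 'cV[int]_d) : orbit_point I theta -> (forall l, s l -> span_lattice I (h l)) ->
  theta (\sum_(l | s l) t l *: h l) = \prod_(l | s l) theta (h l) ^ t l.
Proof.
move=> tP Ih; have [t0 tD _] := tP.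
have [] : span_lattice I (\sum_(l | s l) t l *: h l) /\
  theta (\sum_(l | s l) t l *: h l) = \prod_(l | s l) theta (h l) ^ t l; last by [].
apply: (big_rec2 (fun a z => span_lattice I a /\ theta a = z)).
  by rewrite span_lattice0.
move=> l z a sl [Ia <-].
have Itl : span_lattice I (t l *: h l).
  have [->|s0] := eqVneq (t l) 0; first by rewrite scale0r span_lattice0.
  by rewrite span_lattice_divide ?Ih.
by rewrite span_latticeD // tD // (orbit_pointZ _ tP) ?Ih.
Qed.

Section Parametrization.
Variables (I : {set 'I_n}) (P : 'M[int]_d) (r : nat).
Hypotheses (uP : P \in unitmx) (rd : (r <= d)%N).
Hypothesis spanP : forall a, span_lattice I a <->
  forall i : 'I_d, (r <= i)%N -> (P *m a) i 0 = 0.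
Implicit Types (x : {ffun 'I_d -> F}).

Definition orbit_param x a : F :=
  if span_lattice I a then \prod_i x i ^ (P *m a) i 0 else 0.

Lemma orbit_param_point x : x \in subtorus F d r -> orbit_point I (orbit_param x).
Proof.
move=> xr; split.
- rewrite /orbit_param span_lattice0 big1 // => i _.
  by rewrite mulmx0 mxE expr0z.
- move=> a b Ia Ib; rewrite /orbit_param span_latticeD // Ia Ib -big_split.
  apply: eq_bigr => i _; rewrite mulmxDr mxE expfzDr //.
  exact: (subtorus_neq0 i xr).
- by move=> a /negbTE Ia; rewrite /orbit_param Ia.
Qed.

Definition basis_vector (i : 'I_d) : 'cV[int]_d := invmx P *m delta_mx i 0.

Lemma basis_vector_span (i : 'I_d) : (i < r)%N -> span_lattice I (basis_vector i).
Proof.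
move=> ir; apply/spanP => i' ri'; rewrite mulKVmx // mxE.
by rewrite (_ : (i' == i) = false) //; apply: contraTF ir => /eqP <-; rewrite -leqNgt.
Qed.

Lemma orbit_param_basis x (i : 'I_d) : (i < r)%N -> orbit_param x (basis_vector i) = x i.
Proof.
move=> ir; rewrite /orbit_param basis_vector_span // mulKVmx //.
rewrite (bigD1 i) //= big1 => [|i' /negbTE ii'].
  by rewrite mxE !eqxx mulr1 expr1z.
by rewrite mxE ii' expr0z.
Qed.

Lemma orbit_param_inj : {in subtorus F d r &, injective orbit_param}.
Proof.
move=> x y; rewrite !inE => /forallP xr /forallP yr e; apply/ffunP => i.
have := xr i; have := yr i; case: (ltnP i r) => [ir _ _|_ /eqP -> /eqP -> //].
by rewrite -!orbit_param_basis // e.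
Qed.

Lemma orbit_param_surj theta : orbit_point I theta ->
  exists2 x, x \in subtorus F d r & theta = orbit_param x.
Proof.
move=> tP; have [_ _ tZ] := tP.
exists [ffun i : 'I_d => if (i < r)%N then theta (basis_vector i) else 1].
  rewrite inE; apply/forallP => i; rewrite ffunE; case: ltnP => [ir|_].
    by rewrite (orbit_point_neq0 _ tP) basis_vector_span.
  by [].
apply/funext => a; rewrite /orbit_param; case: ifPn => [Ia|/tZ //].
have ea : a = \sum_(i < d | (i < r)%N) (P *m a) i 0 *: basis_vector i.
  rewrite -{1}[a](mulKmx uP) {1}[P *m a]matrix_sum_delta mulmx_sumr.
  rewrite [RHS]big_mkcond; apply: eq_bigr => i _; rewrite big_ord1 -scalemxAr.
  case: ltnP => // ri; have /spanP/(_ i ri) := Ia; rewrite /= => ->.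
  by rewrite scale0r.
rewrite {1}ea (orbit_point_lincomb _ tP) => [|i]; last exact: basis_vector_span.
rewrite [LHS]big_mkcond; apply: eq_bigr => i _; rewrite ffunE.
by case: ifP => // _; rewrite exp1rz.
Qed.

End Parametrization.

Lemma dvdz_unitmx (k : int) (M : 'M[int]_d) (z : 'cV[int]_d) : M \in unitmx ->
  [forall i, (k %| (M *m z) i ord0)%Z] = [forall i, (k %| z i ord0)%Z].
Proof.
move=> uM; have stable (B : 'M[int]_d) (y : 'cV[int]_d) :
    [forall i, (k %| y i ord0)%Z] -> [forall i, (k %| (B *m y) i ord0)%Z].
  move=> /forallP yk; apply/forallP => i; rewrite mxE; apply: rpred_sum => j _.
  by rewrite dvdz_mull.
by apply/idP/idP; [move/(stable (invmx M)); rewrite mulKmx | exact: stable].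
Qed.

(** Translating by a vertex does not change relations of degree 0, and a unimodular
    matrix preserves divisibility of all coordinates. So the truncation to a
    face, in the coordinates of its lattice, has no relations but those between
    all exponents. *)
Lemma relations_face (P : 'M[int]_d) (i0 : 'I_n) : P \in unitmx ->
  relations F (P *m (m - \matrix_(i, j) m i i0)) = relations F m.
Proof.
move=> uP; apply/setP => v; rewrite !inE; apply: andb_id2l => v1.
pose w : 'cV[int]_n := \col_j (v j : nat)%:Z.
have E (M : 'M[int]_(d, n)) : [forall i, (Q%:Z %| \sum_j M i j * (v j : nat)%:Z)%Z] =
    [forall i, (Q%:Z %| ((M *m w) i ord0))%Z].
  apply: eq_forallb => i; rewrite mxE; congr (_ %| _)%Z.
  by apply: eq_bigr => j _; rewrite mxE.
rewrite !E -mulmxA; set m' := (m - _).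
rewrite dvdz_unitmx //; apply: eq_forallb => i.
have -> : (m' *m w) i ord0 = (m *m w) i ord0 - m i i0 * \sum_j (v j : nat)%:Z.
  rewrite /m' mulmxBl !mxE mulr_sumr; congr (_ - _).
  by apply: eq_bigr => j _; rewrite !mxE.
by rewrite rpredBr // dvdz_mull.
Qed.

Lemma orbit_count I : is_face I ->
  exists (X : {set {ffun 'I_d -> F}}) (h : {ffun 'I_d -> F} -> 'cV[int]_d -> F),
  [/\ {in X &, injective h},
      forall theta, (exists2 x, x \in X & theta = h x) <->
                    orbit_point I theta /\ orbit_equation m u I theta
    & q%:R * #|X|%:R = Q%:R ^+ face_dim I + Q%:R ^- #|I| * Q%:R ^+ (face_dim I).+1 *
        \sum_(v in relations F m | supported v I) gauss_term psi chi u I v].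
Proof.
move=> fI; have [P [uP rd spanP]] := span_lattice_basis G fI.
have /andP[/set0Pn[i0 i0I] _] := fI.
pose e := P *m (m - \matrix_(i, j) m i i0).
have eE (i : 'I_d) j : e i j = (P *m (mu j - mu i0)) i 0.
  by rewrite !mxE; apply: eq_bigr => l _; rewrite !mxE.
have eq_at x : \sum_(j in I) u j * monomial e x j =
    \sum_(j in I) u j * orbit_param I P x (mu j - mu i0).
  apply: eq_bigr => j jI; rewrite /orbit_param (mu_span G) // jI; congr (_ * _).
  by apply: eq_bigr => i _; rewrite eE.
exists [set x in subtorus F d (face_dim I) | \sum_(j in I) u j * monomial e x j == 0]%SET.
exists (orbit_param I P); split.
- by move=> x y; rewrite !inE => /andP[xr _] /andP[yr _]; apply: (orbit_param_inj uP spanP); rewrite inE.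
- move=> theta; split.
    move=> [x]; rewrite inE eq_at => /andP[xr /eqP xe] ->.
    have tP := orbit_param_point I P xr; split=> //.
    exact: (orbit_equation_at G fI tP i0I xe).
  move=> [tP te]; have [x xr ex] := orbit_param_surj uP spanP tP.
  by exists x => //; rewrite inE eq_at -ex xr te ?eqxx.
- rewrite -(relations_face i0 uP) -/e; apply: torus_count => // i j ri jI.
  have /spanP : span_lattice I (mu j - mu i0) by rewrite (mu_span G).
  by rewrite eE; apply.
Qed.

End OrbitCount.

(** * Gale duality modulo [q - 1] *)

Section Residues.
Variable F : finFieldType.
Local Notation Q := #|F|.-1.

Lemma residue_subproof (z : int) : (`|(z %% Q%:Z)%Z| < Q)%N.
Proof.
have Q0 := Q_gt0 F; rewrite -ltz_nat gez0_abs ?modz_ge0 ?ltz_pmod //.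
by rewrite -lt0n.
Qed.

Definition residue (z : int) : 'I_Q := Ordinal (residue_subproof z).

Lemma residueE (z : int) : (Q%:Z %| (residue z : nat)%:Z - z)%Z.
Proof.
have Q0 := Q_gt0 F; rewrite /= gez0_abs; last by rewrite modz_ge0 // -lt0n.
by rewrite {2}(divz_eq z Q) opprD addrA addrAC subrr add0r rpredN dvdz_mull.
Qed.

Lemma eq_residue (s t : 'I_Q) : (Q%:Z %| (s : nat)%:Z - (t : nat)%:Z)%Z -> s = t.
Proof.
move=> st; apply/val_inj => /=.
have := ltn_ord s; have := ltn_ord t.
move: st => /dvdzP[z e] tQ sQ.
have [z0|[z1|z1]] : z = 0 \/ 1 <= z \/ z <= -1 by lia.
- by move/eqP: e; rewrite z0 mul0r subr_eq0 => /eqP[].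
- have : Q%:Z <= z * Q%:Z by rewrite ler_peMl.
  by rewrite -e; lia.
- have : Q%:Z <= - z * Q%:Z by rewrite ler_peMl //; lia.
  by rewrite mulNr -e; lia.
Qed.

Lemma sum_mod (J : finType) (h a b : J -> int) :
  (forall j, (Q%:Z %| a j - b j)%Z) ->
  (Q%:Z %| \sum_j h j * a j - \sum_j h j * b j)%Z.
Proof.
move=> ab; rewrite -sumrB; apply: rpred_sum => j _.
by rewrite -mulrBr dvdz_mull.
Qed.

Lemma dvdz_cong (a b : int) : (Q%:Z %| a - b)%Z -> (Q%:Z %| a)%Z = (Q%:Z %| b)%Z.
Proof. by move=> ab; rewrite -{1}(subrK b a) rpredDl. Qed.

End Residues.

Section GaleData.
Variables (d : nat) (m : 'M[int]_(d, d.+2)) (gamma : 'I_d.+2 -> int).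
Hypothesis galeP : gale_dual m gamma.
Hypothesis gamma_neq0 : forall j, gamma j != 0.
Variable f : 'M[int]_(d, d.+2).
Hypothesis fP : kernel_basis gamma f.
Variables (c : 'M[int]_d) (r : 'cV[int]_d).
Hypothesis mE : m = c *m f + r *m const_mx 1.
Variables (A H : 'M[int]_d).
Hypotheses (uA : A \in unitmx) (HE : H = A *m c) (HNF : hermite_normal H).
Variable rho : 'M[int]_(d, d.+2).
Hypothesis rhoP : rho_system f rho.

Lemma f_rho : f *m rho^T = 1%:M.
Proof.
apply/matrixP => i k; rewrite !mxE natz -rhoP.2.
by apply: eq_bigr => j _; rewrite mxE mulrC.
Qed.

(** The vector [gamma_j e_i - gamma_i e_j] is orthogonal to [gamma], so it is an
    integral combination of 1 and the rows of [f]. *)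
Lemma gale_minor i j : exists (s : int) (b : 'I_d -> int),
  forall l, gamma j *+ (l == i) - gamma i *+ (l == j) = s + \sum_k b k * f k l.
Proof.
pose x : 'rV[int]_d.+2 := \row_l (gamma j *+ (l == i) - gamma i *+ (l == j)).
have gx : \sum_l gamma l * x 0 l = 0.
  under eq_bigr do rewrite mxE mulrBr.
  rewrite sumrB (bigD1 i) //= big1 => [|l /negbTE ->]; last by rewrite mulr0.
  rewrite eqxx (bigD1 j) //= big1 => [|l /negbTE ->]; last by rewrite mulr0.
  by rewrite eqxx !addr0 mulrC subrr.
have [b [e _]] := fP.2 x gx; exists (lsubmx b 0 0), (fun k => rsubmx b 0 k) => l.
transitivity (x 0 l); first by rewrite mxE.
rewrite e -{1}[b]hsubmxK mul_row_col !mxE big_ord1 !mxE mulr1.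
by congr (_ + _).
Qed.

(** If [v] is orthogonal to 1 and to the rows of [f], over the integers or modulo
    [q - 1], then it is proportional to [gamma] in the same sense. *)
Lemma gale_minor_pairing (v : 'I_d.+2 -> int) i j : exists (s : int) (b : 'I_d -> int),
  v i * gamma j - v j * gamma i = s * (\sum_l v l) + \sum_k b k * (\sum_l f k l * v l).
Proof.
have [s [b e]] := gale_minor i j; exists s, b.
transitivity (\sum_l (gamma j *+ (l == i) - gamma i *+ (l == j)) * v l).
  have pick a l0 : \sum_l (a *+ (l == l0)) * v l = a * v l0.
    by rewrite (bigD1 l0) //= eqxx big1 ?addr0 // => l /negbTE ->; rewrite mul0r.
  under eq_bigr do rewrite mulrBl.
  by rewrite sumrB !pick ![v _ * _]mulrC.
under eq_bigr do rewrite e mulrDl.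
rewrite big_split /= mulr_sumr; congr (_ + _).
under eq_bigr do rewrite mulr_suml.
rewrite exchange_big; apply: eq_bigr => k _; rewrite mulr_sumr.
by apply: eq_bigr => l _; rewrite mulrA.
Qed.

Lemma det_c_neq0 : \det c != 0.
Proof.
have [upper diag _] := HNF.
have : \det H != 0.
  rewrite -det_tr det_trig; last by apply/is_trig_mxP => i j ij; rewrite mxE upper.
  by apply/prodf_neq0 => i _; rewrite mxE gt_eqF.
by rewrite HE det_mulmx mulf_eq0 negb_or => /andP[].
Qed.

Lemma kernel_c (v : 'cV[int]_d) : c *m v = 0 -> v = 0.
Proof.
move=> cv; have : \adj c *m (c *m v) = 0 by rewrite cv mulmx0.
rewrite mulmxA mul_adj_mx mul_scalar_mx => /colP e; apply/colP => k.
have /eqP := e k; rewrite !mxE mulf_eq0 (negbTE det_c_neq0) => /eqP.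
by [].
Qed.

(** As [f rho^T = 1] and [m = c f] up to multiples of 1, [rho^T] composed with
    the adjugate of [c] is a right inverse of [m] up to [det c]. *)
Definition splitting_mx : 'M[int]_(d.+2, d) := Num.sg (\det c) *: (rho^T *m \adj c).

Lemma gale_splittingP : gale_splitting m gamma `|\det c| splitting_mx.
Proof.
have [g1 g2 _] := galeP; have one_rho : (const_mx 1 : 'rV[int]_d.+2) *m rho^T = 0.
  apply/rowP => k; rewrite !mxE -[RHS](rhoP.1 k); apply: eq_bigr => j _.
  by rewrite !mxE mul1r.
split=> //.
- by rewrite normr_gt0 det_c_neq0.
- rewrite -scalemxAr mulmxA mE mulmxDl -mulmxA f_rho mulmx1 -[r *m _ *m _]mulmxA.
  rewrite one_rho mulmx0 addr0 mul_mx_adj; apply/matrixP => i j; rewrite !mxE.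
  by rewrite mulrnAr -normrEsg.
- move=> i; under eq_bigr do rewrite mxE.
  rewrite -mulr_sumr (_ : \sum_j _ = 0) ?mulr0 //.
  transitivity (((const_mx 1 : 'rV[int]_d.+2) *m (rho^T *m \adj c)) 0 i).
    by rewrite [RHS]mxE; apply: eq_bigr => j _; rewrite [const_mx _ _ _]mxE mul1r.
  by rewrite mulmxA one_rho mul0mx mxE.
- move=> v mv v1 i j; apply/eqP; rewrite -subr_eq0.
  have [s [b ->]] := gale_minor_pairing (fun l => v l 0) i j.
  have fv : f *m v = 0.
    apply: kernel_c; move: mv; rewrite mE mulmxDl -!mulmxA.
    rewrite (_ : const_mx 1 *m v = 0) ?mulmx0 ?addr0 //.
    apply/matrixP => i1 j1; rewrite !ord1 !mxE -[RHS]v1.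
    by apply: eq_bigr => l _; rewrite mxE mul1r.
  rewrite v1 mulr0 add0r big1 // => k _.
  suff -> : \sum_l f k l * v l 0 = 0 by rewrite mulr0.
  by have := congr1 (fun M : 'cV[int]_d => M k 0) fv; rewrite !mxE.
Qed.

Lemma gale_bezout : exists b : 'I_d.+2 -> int, \sum_j b j * gamma j = 1.
Proof.
have [_ _ g1] := galeP.
suff [b bE] : exists b : 'I_d.+2 -> int,
    \sum_j b j * gamma j = (\big[gcdn/0%N]_j `|gamma j|%N)%:Z.
  by exists b; rewrite bE g1.
pose index := index_enum 'I_d.+2.
have : exists b : 'I_d.+2 -> int,
    \sum_(j <- index) b j * gamma j = (\big[gcdn/0%N]_(j <- index) `|gamma j|%N)%:Z.
  have := index_enum_uniq 'I_d.+2; rewrite -/index.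
  elim: index => [|j s IH] /=; first by exists (fun=> 0); rewrite !big_nil.
  move=> /andP[js us]; have [b bE] := IH us.
  pose g := (\big[gcdn/0%N]_(j <- s) `|gamma j|%N)%N.
  have [y [z e]] := Bezoutz (gamma j) g%:Z.
  exists (fun l => if l == j then y else z * b l); rewrite !big_cons eqxx.
  rewrite (_ : \sum_(l <- s) _ = z * g%:Z); last first.
    rewrite -bE mulr_sumr; apply: eq_big_seq => l ls.
    by rewrite (_ : (l == j) = false) ?mulrA //; apply: contraNF js => /eqP <-.
  by rewrite e /gcdz absz_nat.
by [].
Qed.

Section Relations.
Variable F : finFieldType.
Local Notation Q := #|F|.-1.
Implicit Types (lam : {ffun 'I_d -> 'I_Q}) (t : 'I_Q) (v : {ffun 'I_d.+2 -> 'I_Q}).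

Definition relation_of (lt : {ffun 'I_d -> 'I_Q} * 'I_Q) : {ffun 'I_d.+2 -> 'I_Q} :=
  [ffun j => residue F (gamma j * (lt.2 : nat)%:Z - delta_of rho lt.1 j)].

Lemma relation_ofE lam t j :
  (Q%:Z %| (relation_of (lam, t) j : nat)%:Z
           - (gamma j * (t : nat)%:Z - delta_of rho lam j))%Z.
Proof. by rewrite ffunE residueE. Qed.

Lemma sum_delta lam (h : 'I_d.+2 -> int) :
  \sum_j h j * delta_of rho lam j = \sum_k (lam k : nat)%:Z * \sum_j rho k j * h j.
Proof.
rewrite /delta_of; under eq_bigr do rewrite mulr_sumr.
rewrite exchange_big; apply: eq_bigr => k _; rewrite mulr_sumr.
by apply: eq_bigr => j _; rewrite mulrC mulrA.
Qed.

Lemma sum_one_delta lam : \sum_j delta_of rho lam j = 0.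
Proof.
have := sum_delta lam (fun=> 1); under eq_bigr do rewrite mul1r.
move=> ->; rewrite big1 // => k _; under eq_bigr do rewrite mulr1.
by rewrite rhoP.1 mulr0.
Qed.

Lemma sum_f_delta lam i : \sum_j f i j * delta_of rho lam j = (lam i : nat)%:Z.
Proof.
rewrite sum_delta (bigD1 i) //= rhoP.2 eqxx mulr1 big1 ?addr0 // => k ki.
by rewrite rhoP.2 eq_sym (negbTE ki) mulr0.
Qed.

Lemma sum_f_relation lam (t : 'I_Q) k :
  \sum_j f k j * (gamma j * (t : nat)%:Z - delta_of rho lam j) = - (lam k : nat)%:Z.
Proof.
under eq_bigr do rewrite mulrBr mulrA.
rewrite sumrB sum_f_delta -mulr_suml.
under eq_bigr do rewrite mulrC.
by rewrite fP.1 mul0r sub0r.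
Qed.

Lemma sum_m (v : 'I_d.+2 -> int) i : \sum_j m i j * v j =
  \sum_k c i k * (\sum_j f k j * v j) + r i 0 * \sum_j v j.
Proof.
have e j : m i j = \sum_k c i k * f k j + r i 0.
  by rewrite mE !mxE big_ord1 mxE mulr1.
under eq_bigr do rewrite e mulrDl.
rewrite big_split /= mulr_sumr; congr (_ + _).
under eq_bigr do rewrite mulr_suml.
rewrite exchange_big; apply: eq_bigr => k _; rewrite mulr_sumr.
by apply: eq_bigr => j _; rewrite mulrA.
Qed.

(** [H = A c] with [A] invertible: the conditions defining [Lambda] say that
    [c] kills [lam] modulo [q - 1]. *)
Lemma in_Lambda lam : (lam \in Lambda Q H^T) =
  [forall i, (Q%:Z %| \sum_k c i k * (lam k : nat)%:Z)%Z].
Proof.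
pose w : 'cV[int]_d := \col_k (lam k : nat)%:Z.
have -> : [forall i, (Q%:Z %| \sum_k c i k * (lam k : nat)%:Z)%Z] =
    [forall i, (Q%:Z %| (c *m w) i ord0)%Z].
  by apply: eq_forallb => i; rewrite mxE; congr (_ %| _)%Z; apply: eq_bigr => k _; rewrite mxE.
have -> : (lam \in Lambda Q H^T) = [forall i, (Q%:Z %| (A *m (c *m w)) i ord0)%Z].
  rewrite inE mulmxA -HE; apply: eq_forallb => i; rewrite mxE; congr (_ %| _)%Z.
  by apply: eq_bigr => k _; rewrite !mxE mulrC.
by rewrite dvdz_unitmx.
Qed.

Lemma relation_of_in lam t : lam \in Lambda Q H^T -> relation_of (lam, t) \in relations F m.
Proof.
have [g1 g2 _] := galeP; rewrite in_Lambda => /forallP cl.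
have v1 : \sum_j (gamma j * (t : nat)%:Z - delta_of rho lam j) = 0.
  by rewrite sumrB -mulr_suml g1 mul0r sum_one_delta subrr.
rewrite inE; apply/andP; split.
  have := sum_mod (fun=> 1) (fun j => relation_ofE lam t j).
  under eq_bigr do rewrite mul1r; under [X in _ - X]eq_bigr do rewrite mul1r.
  by rewrite v1 subr0.
apply/forallP => i; rewrite (dvdz_cong (sum_mod (m i) (fun j => relation_ofE lam t j))).
rewrite sum_m v1 mulr0 addr0.
under eq_bigr do rewrite sum_f_relation mulrN.
by rewrite sumrN rpredN.
Qed.

(** The rows of [f] recover [lam], and a Bezout relation for [gamma] recovers
    [t]. *)
Lemma relation_of_inj : injective relation_of.
Proof.
move=> [lam t] [lam' t'] e.
have cong j : (Q%:Z %| (gamma j * (t : nat)%:Z - delta_of rho lam j)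
                     - (gamma j * (t' : nat)%:Z - delta_of rho lam' j))%Z.
  have := relation_ofE lam t j; have := relation_ofE lam' t' j; rewrite e.
  have E (x y z : int) : x - y = (z - y) - (z - x) by ring.
  move=> h h'; rewrite (E _ _ (relation_of (lam', t') j : nat)%:Z).
  by rewrite rpredB.
have el : lam = lam'.
  apply/ffunP => k; apply: eq_residue.
  have := sum_mod (f k) cong; rewrite !sum_f_relation.
  by rewrite opprK addrC -opprB rpredN.
subst lam'; congr pair; apply: eq_residue.
have [b b1] := gale_bezout.
have cong2 j : (Q%:Z %| gamma j * (t : nat)%:Z - gamma j * (t' : nat)%:Z)%Z.
  by have := cong j; rewrite opprB addrA subrK.
have := sum_mod b cong2.
under eq_bigr do rewrite mulrA; under [X in _ - X]eq_bigr do rewrite mulrA.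
by rewrite -!mulr_suml b1 !mul1r.
Qed.

(** Take [lam = - f v]. Then [v + delta lam] is orthogonal to 1 and to the rows of
    [f], hence a multiple of [gamma], whose factor a Bezout relation gives. *)
Lemma relation_of_surj v : v \in relations F m ->
  exists2 lt, lt.1 \in Lambda Q H^T & v = relation_of lt.
Proof.
have [g1 g2 _] := galeP.
rewrite inE => /andP[v1 /forallP mv].
pose fv k := \sum_j f k j * (v j : nat)%:Z.
pose lam : {ffun 'I_d -> 'I_Q} := [ffun k => residue F (- fv k)].
have lamE k : (Q%:Z %| (lam k : nat)%:Z - - fv k)%Z by rewrite ffunE residueE.
pose w j := (v j : nat)%:Z + delta_of rho lam j.
have w1 : (Q%:Z %| \sum_j w j)%Z by rewrite big_split /= sum_one_delta addr0.
have fw k : (Q%:Z %| \sum_j f k j * w j)%Z.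
  under eq_bigr do rewrite mulrDr.
  by rewrite big_split /= sum_f_delta addrC -[X in _ + X]opprK lamE.
have [b b1] := gale_bezout; pose s := \sum_j b j * w j.
have ws j : (Q%:Z %| gamma j * s - w j)%Z.
  have -> : gamma j * s - w j = \sum_i b i * (w i * gamma j - w j * gamma i).
    under [RHS]eq_bigr do rewrite mulrBr mulrA [b _ * (w j * _)]mulrCA.
    by rewrite sumrB -mulr_suml -mulr_sumr b1 mulr1 mulrC.
  apply: rpred_sum => i _; rewrite dvdz_mull //.
  have [y [z ->]] := gale_minor_pairing w i j.
  rewrite rpredD ?dvdz_mull //; apply: rpred_sum => k _.
  by rewrite dvdz_mull.
exists (lam, residue F s) => /=.
  rewrite in_Lambda; apply/forallP => i; rewrite (dvdz_cong (sum_mod (c i) lamE)).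
  under eq_bigr do rewrite mulrN; rewrite sumrN rpredN.
  by have := mv i; rewrite sum_m rpredDr // dvdz_mull.
apply/ffunP => j; apply: eq_residue.
have h1 := relation_ofE lam (residue F s) j.
have h2 : (Q%:Z %| gamma j * (residue F s : nat)%:Z - gamma j * s)%Z.
  by rewrite -mulrBr dvdz_mull // residueE.
have -> : (v j : nat)%:Z - (relation_of (lam, residue F s) j : nat)%:Z =
  - ((relation_of (lam, residue F s) j : nat)%:Z
       - (gamma j * (residue F s : nat)%:Z - delta_of rho lam j))
  - (gamma j * (residue F s : nat)%:Z - gamma j * s) - (gamma j * s - w j).
  by rewrite /w; ring.
by apply: rpredB (ws j); apply: rpredB h2; rewrite rpredN.
Qed.

Lemma sum_relations (T : nmodType) (h : {ffun 'I_d.+2 -> 'I_Q} -> T) :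
  \sum_(v in relations F m) h v =
  \sum_(lam in Lambda Q H^T) \sum_(t < Q) h (relation_of (lam, t)).
Proof.
rewrite pair_big_dep /=.
have -> : relations F m = (relation_of @: [set lt | lt.1 \in Lambda Q H^T])%SET.
  apply/setP => v; apply/idP/imsetP => [/relation_of_surj[lt ltL ->]|[[lam t] + ->]].
    by exists lt => //; rewrite inE.
  by rewrite inE => /relation_of_in.
rewrite big_imset /=; last by move=> x y _ _; exact: relation_of_inj.
by apply: eq_big => [lt|[lam t] _ //]; rewrite inE andbT.
Qed.

End Relations.
End GaleData.

(** * Sums over faces *)

Section SubsetSums.
Variables (K : comRingType) (T : finType).
Implicit Types (A S I : {set T}).

(** Expand the product over [t] of [x + y], without [y] for [t] in [A]. *)
Lemma sum_supersets (x y : K) A :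
  \sum_(I : {set T} | A \subset I) x ^+ #|I| * y ^+ #|~: I| =
  x ^+ #|A| * (x + y) ^+ #|~: A|.
Proof.
have -> : x ^+ #|A| * (x + y) ^+ #|~: A| = \prod_t (x + if t \in A then 0 else y).
  rewrite (bigID (mem A)) /=; congr (_ * _).
    by under eq_bigr => t tA do rewrite tA addr0; rewrite prodr_const.
  under eq_bigr => t /negbTE tA do rewrite tA.
  rewrite -prodr_const; apply: eq_bigl => t; by rewrite inE.
rewrite bigA_distr big_mkcond; apply: eq_bigr => I _.
case: ifPn => [AI|/fintype.subsetPn[t tA tI]]; last first.
  by rewrite (bigD1 t) //= (negbTE tI) tA mul0r.
rewrite (bigID (mem I)) /=; congr (_ * _).
  by under [RHS]eq_bigr => t tI do rewrite tI; rewrite prodr_const.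
rewrite -prodr_const; apply: eq_big => [t|t]; first by rewrite inE.
rewrite inE => tI; rewrite (negbTE tI) ifF //; apply: contraNF tI.
exact: (fintype.subsetP AI).
Qed.

Lemma sum_supersets_avoid (x y : K) S A (B : {set T}) :
  \sum_(I : {set T} | [&& S \subset I, ~~ (A \subset I) & ~~ (B \subset I)])
     x ^+ #|I| * y ^+ #|~: I| =
  x ^+ #|S| * (x + y) ^+ #|~: S|
  - x ^+ #|S :|: A| * (x + y) ^+ #|~: (S :|: A)|
  - x ^+ #|S :|: B| * (x + y) ^+ #|~: (S :|: B)|
  + x ^+ #|S :|: (A :|: B)| * (x + y) ^+ #|~: (S :|: (A :|: B))|.
Proof.
rewrite -!sum_supersets big_mkcond [X in _ = X - _ - _ + _]big_mkcond.
rewrite [X in _ = _ - X - _ + _]big_mkcond [X in _ = _ - _ - X + _]big_mkcond.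
rewrite [X in _ = _ - _ - _ + X]big_mkcond -!sumrB -big_split.
apply: eq_bigr => I _ /=; rewrite !finset.subUset.
case: (S \subset I); case: (A \subset I); case: (B \subset I) => /=; ring.
Qed.

End SubsetSums.

Section Boundary.
Variables (n : nat) (gamma : 'I_n -> int).
Hypothesis gamma_neq0 : forall j, gamma j != 0.
Local Notation Neg := [set j | gamma j < 0]%SET.
Local Notation Pos := [set j | 0 < gamma j]%SET.
Implicit Type I : {set 'I_n}.

Lemma setC_neg : (~: Neg = Pos)%SET.
Proof. by apply/setP => j; rewrite !inE; have := gamma_neq0 j; lia. Qed.

Lemma setC_pos : (~: Pos = Neg)%SET.
Proof. by rewrite -setC_neg finset.setCK. Qed.

Lemma setU_neg_pos : (Neg :|: Pos = [set: 'I_n])%SET.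
Proof. by rewrite -setC_neg finset.setUCr. Qed.

Lemma is_faceE I : is_face gamma I =
  (I != finset.set0) && ((I == [set: 'I_n]%SET) ||
                 (~~ (Neg \subset I) && ~~ (Pos \subset I))).
Proof.
rewrite /is_face; congr (_ && (_ || _)); apply/existsP/andP.
  move=> [p /existsP[k /and4P[gp gk pI kI]]].
  by split; apply/subsetPn; [exists k|exists p]; rewrite ?inE.
move=> [/subsetPn[k + kI] /subsetPn[p + pI]]; rewrite !inE => gk gp.
by exists p; apply/existsP; exists k; apply/and4P.
Qed.

Section Count.
Variables (K : numFieldType) (F : finFieldType).
Local Notation Q := #|F|.-1.
Hypotheses (n5 : n = 5) (neg2 : #|Neg| = 2) (pos3 : #|Pos| = 3).
Implicit Type v : {ffun 'I_n -> 'I_Q}.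

Definition zeros v : {set 'I_n} := [set j | (v j : nat) == 0%N]%SET.

(** The exponent of [q] in the hypergeometric sums, see
    [zero_mult_relation_of]. *)
Definition zero_mult v : nat := minn #|Neg :&: zeros v| #|Pos :&: zeros v|.

Lemma supportedE v I : supported v I = (~: zeros v \subset I).
Proof.
apply/forallP/fintype.subsetP => h j; first by rewrite !inE => /(implyP (h j)).
by apply/implyP => vj; apply: h; rewrite !inE.
Qed.

(** [sum_supersets_avoid] at [x = 1], [y = -1]: a sum over the supersets of a set
    is 0 unless the set is everything. *)
Lemma sum_sign_faces v :
  \sum_(I : {set 'I_n} | [&& ~: zeros v \subset I, ~~ (Neg \subset I) & ~~ (Pos \subset I)])
     (-1) ^+ #|~: I| = (0 < zero_mult v)%N%:R :> K.
Proof.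
have := sum_supersets_avoid 1 (-1 : K) (~: zeros v) Neg Pos.
under eq_bigr do rewrite expr1n mul1r.
move=> ->; rewrite !expr1n !mul1r subrr setU_neg_pos finset.setUT finset.setCT cards0 expr0.
rewrite !finset.setCU setC_neg setC_pos finset.setCK ![_ :&: Neg]finset.setIC ![_ :&: Pos]finset.setIC.
rewrite /zero_mult leq_min !expr0n.
have sub : #|zeros v| = (#|Neg :&: zeros v| + #|Pos :&: zeros v|)%N.
  rewrite -(cardsID Neg (zeros v)) finset.setIC; congr (_ + _)%N.
  by rewrite finset.setDE setC_neg finset.setIC.
rewrite sub; case: #|Neg :&: _| => [|a]; case: #|Pos :&: _| => [|b] //=; ring.
Qed.

(** The empty set is included here, and accounts for the constant term. *)
Lemma sum_power_faces :
  \sum_(I : {set 'I_n} | ~~ (Neg \subset I) && ~~ (Pos \subset I)) Q%:R ^+ #|I| =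
  6 * Q%:R ^+ 3 + 9 * Q%:R ^+ 2 + 5 * Q%:R + 1 :> K.
Proof.
have := sum_supersets_avoid (Q%:R : K) 1 finset.set0 Neg Pos.
under eq_bigl do rewrite finset.sub0set.
under eq_bigr do rewrite expr1n mulr1.
move=> ->; rewrite !finset.set0U setU_neg_pos setC_neg setC_pos neg2 pos3.
rewrite finset.setC0 finset.setCT !cards0 cardsT card_ord n5; ring.
Qed.

End Count.
End Boundary.

(** * The sum over the faces of a bipyramid *)

Section FaceSum.
Variables (m : 'M[int]_(3, 5)) (gamma : 'I_5 -> int).
Hypothesis gamma_neq0 : forall j, gamma j != 0.
Variables (R : realType) (F : finFieldType) (psi chi : F -> R[i]).
Hypothesis psiP : nontrivial_additive_character psi.
Variable u : 'I_5 -> F.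
Local Notation q := #|F|.
Local Notation Q := #|F|.-1.
Local Notation Neg := [set j | gamma j < 0]%SET.
Local Notation Pos := [set j | 0 < gamma j]%SET.
Hypotheses (neg2 : #|Neg| = 2) (pos3 : #|Pos| = 3).
Implicit Types (v : {ffun 'I_5 -> 'I_Q}) (I : {set 'I_5}).
Local Notation V := (relations F m).
Local Notation term := (gauss_term psi chi u).
Local Notation W v := (term [set: 'I_5]%SET v).

Definition zero_relation : {ffun 'I_5 -> 'I_Q} := [ffun=> Ordinal (Q_gt0 F)].

Lemma zero_relation_in : zero_relation \in V.
Proof.
rewrite inE; apply/andP; split; first by rewrite big1 // => j _; rewrite ffunE.
by apply/forallP => i; rewrite big1 // => j _; rewrite ffunE mulr0.
Qed.

Lemma supported_set0 v : supported v finset.set0 = (v == zero_relation).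
Proof.
apply/forallP/eqP => [h|-> j]; last by rewrite ffunE.
apply/ffunP => j; apply/val_inj; rewrite ffunE /=.
by have := h j; rewrite inE implybF negbK => /eqP.
Qed.

(** A factor where the relation vanishes is [g(0) = -1]. *)
Lemma gauss_term_supported I v : supported v I -> term I v = W v * (-1) ^+ #|~: I|.
Proof.
move=> sv; rewrite /gauss_term [X in _ = X * _](bigID (mem I)) /=.
rewrite [X in _ = X * _ * _](eq_bigl (mem I)) => [|j]; last by rewrite inE.
rewrite [X in _ = _ * X * _](eq_bigr (fun=> -1)) => [|j /andP[_ jI]]; last first.
  by rewrite (supportedP sv jI) oppr0 (gauss_sum0 _ psiP) expr0 mulr1.
rewrite [X in _ = _ * X * _](eq_bigl (mem (~: I))) => [|j]; last by rewrite !inE.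
by rewrite prodr_const -mulrA -exprMn mulrNN mulr1 expr1n mulr1.
Qed.

Lemma W_zero_relation : W zero_relation = -1.
Proof.
rewrite /gauss_term (eq_bigr (fun=> -1)) => [|j _].
  by rewrite prodr_const cardsT card_ord -signr_odd.
by rewrite ffunE oppr0 (gauss_sum0 _ psiP) expr0 mulr1.
Qed.

Lemma zero_mult_zero_relation : zero_mult gamma zero_relation = 2.
Proof.
have -> : zero_mult gamma zero_relation = minn #|Neg| #|Pos|.
  by congr minn; apply: eq_card => j; rewrite !inE ffunE eqxx andbT.
by rewrite neg2 pos3.
Qed.

(** A relation vanishing at both negative indices and at two positive ones has
    at most one non-zero entry, and its entries sum to 0. *)
Lemma zero_mult_le1 v : v \in V -> v != zero_relation -> (zero_mult gamma v <= 1)%N.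
Proof.
rewrite inE => /andP[v1 _]; apply: contraR; rewrite -ltnNge leq_min => /andP[a2 b2].
have negz : (Neg \subset zeros v).
  apply/finset.setIidPl/eqP; rewrite eqEcard finset.subsetIl neg2; exact: a2.
have posz : (#|Pos :\: zeros v| <= 1)%N.
  by rewrite -(leq_add2l #|Pos :&: zeros v|) cardsID pos3 addn1 ltnS; exact: b2.
have nzP j : (v j : nat) != 0%N -> j \in (Pos :\: zeros v)%SET.
  move=> vj; rewrite !inE vj; have := gamma_neq0 j.
  have : ~~ (gamma j < 0); last by lia.
  by apply: contra vj => gj; have := fintype.subsetP negz j; rewrite !inE => /(_ gj).
apply/eqP/ffunP => j; apply: (@eq_residue F); rewrite ffunE subr0.
have [->//|vj] := eqVneq (v j : nat) 0%N.
suff e : \sum_i (v i : nat)%:Z = (v j : nat)%:Z by rewrite -e.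
rewrite (bigD1 j) //= big1 ?addr0 // => i ij.
apply/eqP; rewrite eqz_nat; apply: contraNT ij => vi; apply/eqP.
exact: (card_le1_eqP posz j i (nzP _ vj) (nzP _ vi)).
Qed.

Local Notation face_rhs I := (Q%:R ^+ @face_dim 3 5 I +
  Q%:R ^- #|I| * Q%:R ^+ (@face_dim 3 5 I).+1 * \sum_(v in V | supported v I) term I v).

(** By [gauss_term_supported], [sum_power_faces] and [sum_sign_faces] the left
    side is a combination of the [W v] with coefficient [1 / Q] from the polytope
    and 1 from its boundary if [zero_mult v > 0]. For [v] not 0 this is
    [q ^ zero_mult v / Q]; the discrepancy at [v = 0] goes into the polynomial. *)
Lemma face_sum :
  \sum_(I | is_face gamma I) face_rhs I =
  q%:R ^+ 3 + 3 * q%:R ^+ 2 + q%:R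
  + Q%:R^-1 * \sum_(v in V) W v * q%:R ^+ zero_mult gamma v.
Proof.
have Q0 : Q%:R != 0 :> R[i] by exact: Q_neq0.
have qE : q%:R = Q%:R + 1 :> R[i] by rewrite natr1 -card_F.
pose avoid I := ~~ (Neg \subset I) && ~~ (Pos \subset I).
have N0 : Neg != finset.set0 by rewrite -card_gt0 neg2.
have P0 : Pos != finset.set0 by rewrite -card_gt0 pos3.
pose rest I := Q%:R ^+ #|I| / Q%:R + \sum_(v in V | supported v I) term I v.
have faceT : is_face gamma [set: 'I_5]%SET.
  by rewrite is_faceE // eqxx andbT -card_gt0 cardsT card_ord.
rewrite (bigD1 _ faceT) /=.
have -> : \sum_(I | is_face gamma I && (I != [set: 'I_5]%SET)) face_rhs I =
    \sum_(I | avoid I && (I != finset.set0)) rest I.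
  apply: eq_big => [I|I]; rewrite is_faceE //.
    rewrite /avoid; have [->|_] := eqVneq I finset.set0; first by rewrite !andbF.
    have [->|_] /= := eqVneq I [set: 'I_5]%SET; last by rewrite !andbT.
    by rewrite finset.subsetT.
  move=> /andP[/andP[I0 _] nT]; rewrite /face_dim (negbTE nT) /rest.
  have i0 : (0 < #|I|)%N by rewrite card_gt0.
  rewrite prednK // mulVf ?expf_neq0 // mul1r; congr (_ + _).
  by rewrite -{2}(prednK i0) exprSr mulfK.
(* Include the empty set, to sum over all supersets. *)
have -> : \sum_(I | avoid I && (I != finset.set0)) rest I =
   \sum_(I | avoid I) rest I - (Q%:R^-1 + 1).
  rewrite [in RHS](bigD1 finset.set0) /=; last by rewrite /avoid !finset.subset0 N0.
  have -> : rest finset.set0 = Q%:R^-1 + 1; last by rewrite addrAC subrr add0r.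
  rewrite /rest cards0 expr0 mul1r; congr (_ + _).
  under eq_bigl do rewrite supported_set0.
  rewrite (big_pred1 zero_relation) => [|v]; first by rewrite /gauss_term big_set0.
  by rewrite andb_idl // => /eqP ->; exact: zero_relation_in.
have -> : \sum_(I | avoid I) rest I =
    (6 * Q%:R ^+ 3 + 9 * Q%:R ^+ 2 + 5 * Q%:R + 1) / Q%:R
    + \sum_(v in V) W v * (0 < zero_mult gamma v)%N%:R.
  rewrite big_split /= -mulr_suml sum_power_faces //; congr (_ + _).
  under eq_bigr do rewrite big_mkcondr.
  rewrite exchange_big; apply: eq_bigr => v _ /=.
  rewrite -(@sum_sign_faces _ gamma gamma_neq0) mulr_sumr -big_mkcondr.
  apply: eq_big => [I|I]; first by rewrite supportedE andbC.
  by move=> /andP[_]; exact: gauss_term_supported.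
have -> : \sum_(v in V) W v * q%:R ^+ zero_mult gamma v =
   \sum_(v in V) W v + Q%:R * (\sum_(v in V) W v * (0 < zero_mult gamma v)%N%:R)
   - (q%:R ^+ 2 - 1 - Q%:R).
  rewrite mulr_sumr -big_split /=.
  rewrite !(bigD1 zero_relation zero_relation_in) /=.
  rewrite W_zero_relation zero_mult_zero_relation /=.
  rewrite (eq_bigr (fun v => W v + Q%:R * (W v * (0 < zero_mult gamma v)%N%:R))).
    by ring.
  move=> v /andP[vV v0]; have := zero_mult_le1 vV v0.
  case: (zero_mult gamma v) => [|[|//]] _.
    by rewrite expr0 mulr1 [X in _ + _ * X]mulr0 mulr0 addr0.
  by rewrite expr1 [X in _ + _ * X]mulr1 qE; ring.
rewrite /face_dim eqxx cardsT card_ord.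
under [\sum_(v in V | supported v _) _]eq_bigl => v.
  rewrite (_ : supported v [set: 'I_5]%SET) ?andbT; last first.
    by apply/forallP => j; rewrite inE implybT.
  over.
set S := \sum_(v in V) W v; set S' := \sum_(v in V) _ * _.
by rewrite qE; field.
Qed.

End FaceSum.

(** * The hypergeometric terms and the conclusion *)

Section Terms.
Variables (d : nat) (gamma : 'I_d.+2 -> int).
Variables (R : realType) (F : finFieldType) (psi chi : F -> R[i]).
Hypothesis psiP : nontrivial_additive_character psi.
Hypothesis chiP : multiplicative_character chi.
Hypothesis chi_order : character_order chi #|F|.-1.
Variable u : 'I_d.+2 -> F.
Hypothesis u_neq0 : forall j, u j != 0.
Variable rho : 'M[int]_(d, d.+2).
Local Notation Q := #|F|.-1.
Implicit Types (lam : {ffun 'I_d -> 'I_Q}) (t : 'I_Q).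

Lemma relation_of_eq0 lam t j :
  ((relation_of gamma rho (lam, t) j : nat) == 0%N) =
  (Q%:Z %| - gamma j * (t : nat)%:Z + delta_of rho lam j)%Z.
Proof.
have Q0 := Q_gt0 F.
have h := relation_ofE gamma rho lam t j.
transitivity (Q%:Z %| (relation_of gamma rho (lam, t) j : nat)%:Z)%Z.
  apply/eqP/idP => [->|dv]; first by rewrite dvdz0.
  suff -> : relation_of gamma rho (lam, t) j = Ordinal Q0 by [].
  by apply: eq_residue; rewrite subr0.
by rewrite (dvdz_cong h) -rpredN; congr (_ %| _)%Z; ring.
Qed.

Lemma zero_mult_relation_of lam t :
  zero_mult gamma (relation_of gamma rho (lam, t)) =
  s_mult R Q gamma (delta_of rho lam) (- (t : nat)%:Z).
Proof.
rewrite s_multE; last exact: Q_gt0.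
by congr minn; apply: eq_card => j; rewrite !inE relation_of_eq0.
Qed.

Lemma prod_param_exp (e : 'I_d.+2 -> int) (t : nat) :
  chi (\prod_j u j ^ e j) ^+ t = \prod_j chi (u j) ^ (e j * t%:Z).
Proof.
rewrite (chi_prod chiP); last by move=> j; rewrite expfz_neq0.
rewrite -prodrXl; apply: eq_bigr => j _.
by rewrite (chiX chiP) // exprnP exprz_exp.
Qed.

Lemma gauss_term_relation_of lam t :
  gauss_term psi chi u [set: 'I_d.+2]%SET (relation_of gamma rho (lam, t)) =
  (character_pow chi lam (sigma_param rho u))^-1 * chi (t_param gamma u) ^+ t
  * gauss_prod psi chi (fun j => - gamma j * (t : nat)%:Z + delta_of rho lam j).
Proof.
rewrite /gauss_term big_split /= mulrC; congr (_ * _); last first.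
  rewrite (eq_bigl predT) => [|j]; last by rewrite inE.
  apply: eq_bigr => j _; apply: (gauss_sum_mod psi chiP chi_order).
  have := relation_ofE gamma rho lam t j; rewrite -rpredN => h.
  by apply: etrans h; congr (_ %| _)%Z; ring.
rewrite (eq_bigl predT) => [|j]; last by rewrite inE.
rewrite /character_pow /t_param /sigma_param prod_param_exp -prodfV.
under [X in _ = X * _]eq_bigr => k _ do rewrite prod_param_exp -prodfV.
rewrite [X in _ = X * _]exchange_big -big_split; apply: eq_bigr => j _ /=.
have cu := chi_nz chiP (u_neq0 j).
rewrite exprnP (chi_exp_mod chiP chi_order (u_neq0 j) (relation_ofE gamma rho lam t j)).
rewrite expfzDr // mulrC; congr (_ * _).
rewrite /delta_of -sumrN -(prod_exprz _ _ cu); apply: eq_bigr => k _.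
by rewrite invr_expz mulrC.
Qed.

End Terms.

Lemma card_eq_I_image (U : Type) (n : nat) (h : 'I_n -> U) (S : set U) :
  injective h -> (forall y, S y <-> exists x, y = h x) -> (S #= `I_n)%card.
Proof.
move=> hinj SE; have -> : S = h @` [set: 'I_n].
  apply/seteqP; split=> y; first by move=> /SE[x ->]; exists x.
  by move=> [x _ <-]; apply/SE; exists x.
apply: card_eq_trans (_ : [set: 'I_n] #= `I_n)%card.
  by apply: inj_card_eq => x y _ _; exact: hinj.
by rewrite card_eq_sym card_II.
Qed.

Lemma card_natr0 (F : finFieldType) : #|F|%:R = 0 :> F.
Proof.
have e : \sum_(x : F) x = \sum_(x : F) (1 + x) by rewrite (reindex_inj (addrI 1)).
rewrite big_split /= sumr_const -[LHS]add0r in e.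
exact/esym/(addIr _ e).
Qed.

Lemma intr_neq0_coprime (F : finFieldType) (z : int) :
  coprime #|F| `|z|%N -> z%:~R != 0 :> F.
Proof.
move=> cop; have [a [b e]] := Bezoutz #|F|%:Z z.
have : (gcdz #|F|%:Z z)%:~R = (1 : F) by rewrite /gcdz absz_nat (eqP cop).
rewrite -e rmorphD !rmorphM /= -pmulrn card_natr0 mulr0 add0r => bz.
by apply: contra_eq_neq bz => ->; rewrite mulr0 eq_sym oner_neq0.
Qed.

Section ClosureCard.
Variables (d n : nat) (m : 'M[int]_(d, n)) (gamma : 'I_n -> int).
Variables (D : int) (N : 'M[int]_(n, d)).
Hypothesis G : gale_splitting m gamma D N.
Variables (R : realType) (F : finFieldType) (psi chi : F -> R[i]).
Hypothesis psiP : nontrivial_additive_character psi.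
Hypothesis chiP : multiplicative_character chi.
Hypothesis chi_order : character_order chi #|F|.-1.
Variable u : 'I_n -> F.
Hypothesis u_neq0 : forall j, u j != 0.
Hypothesis m_inj : injective (fun j => col j m).
Hypothesis n_gt0 : (0 < n)%N.
Local Notation q := #|F|.
Local Notation Q := #|F|.-1.

(** The points are numbered by the pairs of a face and a point of the torus of
    that face, in the coordinates of [orbit_count]. *)
Lemma closure_card : exists c : nat,
  (closure_points (newton_polytope R m) (laurent_of m u) #= `I_c)%card /\
  q%:R * c%:R = \sum_(I | is_face gamma I) (Q%:R ^+ @face_dim d n I +
    Q%:R ^- #|I| * Q%:R ^+ (@face_dim d n I).+1 *
    \sum_(v in relations F m | supported v I) gauss_term psi chi u I v) :> R[i].
Proof.
have ex I : exists Xh : {set {ffun 'I_d -> F}} * ({ffun 'I_d -> F} -> 'cV[int]_d -> F),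
    is_face gamma I ->
    [/\ {in Xh.1 &, injective Xh.2},
        forall theta, (exists2 x, x \in Xh.1 & theta = Xh.2 x) <->
                      orbit_point gamma N I theta /\ orbit_equation m u I theta
      & q%:R * #|Xh.1|%:R = Q%:R ^+ @face_dim d n I +
          Q%:R ^- #|I| * Q%:R ^+ (@face_dim d n I).+1 *
          \sum_(v in relations F m | supported v I) gauss_term psi chi u I v :> R[i]].
  case: (boolP (is_face gamma I)) => [fI|_]; last by exists (finset.set0, fun _ _ => 0).
  by have [X [h XhP]] := orbit_count G psiP chiP chi_order u_neq0 fI; exists (X, h).
have [Xh XhP] := choice ex.
pose A := [set t : {set 'I_n} * {ffun 'I_d -> F} |
            is_face gamma t.1 && (t.2 \in (Xh t.1).1)]%SET.
pose class (t : {set 'I_n} * {ffun 'I_d -> F}) := @orbit_class d n m R F t.1 ((Xh t.1).2 t.2).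
have AP t : t \in A -> is_face gamma t.1 /\ orbit_point gamma N t.1 ((Xh t.1).2 t.2)
    /\ orbit_equation m u t.1 ((Xh t.1).2 t.2).
  rewrite inE => /andP[ft tX]; split=> //; have [_ h _] := XhP _ ft.
  by apply/h; exists t.2.
exists #|A|; split.
  apply: (card_eq_I_image (h := fun i => class (enum_val i))) => [i j e|C].
    have [fi [iP _]] := AP _ (enum_valP i); have [fj [jP _]] := AP _ (enum_valP j).
    apply: enum_val_inj; move: e (enum_valP i) (enum_valP j).
    rewrite /class => /(orbit_class_inj G fi iP fj jP)[].
    case: (enum_val i) (enum_val j) => [I x] [J y] /= eI; subst J => eh.
    rewrite !inE /= => /andP[fI xX] /andP[_ yX]; congr pair.
    by have [inj _ _] := XhP _ fI; exact: inj eh.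
  rewrite (closure_pointsE G u_neq0 m_inj) //; split.
    move=> [I [theta [fI tP te ->]]]; have [_ h _] := XhP _ fI.
    have [x xX ->] := (h theta).2 (conj tP te).
    have IxA : (I, x) \in A by rewrite inE fI.
    by exists (enum_rank_in IxA (I, x)); rewrite /class enum_rankK_in.
  move=> [i ->]; have [fi [iP ie]] := AP _ (enum_valP i).
  by exists (enum_val i).1, ((Xh (enum_val i).1).2 (enum_val i).2).
have -> : #|A| = (\sum_(I | is_face gamma I) #|(Xh I).1|)%N.
  rewrite -sum1_card; under [RHS]eq_bigr do rewrite -sum1_card.
  by rewrite pair_big_dep /=; apply: eq_bigl => t; rewrite inE.
rewrite natr_sum mulr_sumr; apply: eq_bigr => I fI.
by have [_ _ ->] := XhP _ fI.
Qed.

End ClosureCard.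

(** The normalizations by [g delta] and by a power of [q] in the hypergeometric
    sum cancel against the factors in front of it. *)
Lemma normalized_sum (K : fieldType) (n : nat) (q Q cp gd ch : K) (h : 'I_n -> K)
    (s : 'I_n -> nat) (s0 : nat) :
  q != 0 -> Q != 0 -> gd != 0 -> 1 - q = - Q ->
  q * (cp^-1 * q ^ (s0%:Z - 1) * gd *
       ((1 - q)^-1 * \sum_(t < n) h t / gd * q ^ ((s t)%:Z - s0%:Z) * ch ^+ t)) =
  - (Q^-1 * \sum_(t < n) cp^-1 * ch ^+ t * h t * q ^+ s t).
Proof.
move=> q0 Q0 gd0 ->.
rewrite invrN mulNr mulrN mulrN; congr (- _).
rewrite [_ * (Q^-1 * _)]mulrCA [q * (Q^-1 * _)]mulrCA; congr (_ * _).
rewrite !mulr_sumr; apply: eq_bigr => t _.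
have qs0 : q ^+ s0 != 0 by rewrite expf_neq0.
rewrite !expfzDr // exprN1 -!exprnP -exprnN.
transitivity (cp^-1 * ch ^+ t * h t * q ^+ s t * (q / q) * (q ^+ s0 / q ^+ s0) * (gd / gd)).
  by ring.
by rewrite !mulfV // !mulr1.
Qed.

Theorem corollary1p7 (R : realType) (F : finFieldType)
    (psi chi : F -> R[i])
    (hpsi : nontrivial_additive_character psi)
    (hchi : multiplicative_character chi)
    (hord : character_order chi #|F|.-1)
    (d : nat) (m : 'M[int]_(d, d.+2)) (u : 'I_d.+2 -> F)
    (hu : forall j, u j != 0)
    (hm : injective (fun j => col j m))
    (hdim : newton_dim m = d)
    (gamma : 'I_d.+2 -> int)
    (hgale : gale_dual m gamma)
    (hgamma : forall j, gamma j != 0)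
    (f : 'M[int]_(d, d.+2)) (hf : kernel_basis gamma f)
    (c : 'M[int]_d) (r : 'cV[int]_d)
    (hc : m = c *m f + r *m const_mx 1)
    (A H : 'M[int]_d) (hA : A \in unitmx) (hH : H = A *m c)
    (hHNF : hermite_normal H)
    (rho : 'M[int]_(d, d.+2)) (hrho : rho_system f rho)
    (hcop : coprime #|F| `|(\prod_j gamma j)%R|%N)
    (hneg : #|[set j : 'I_d.+2 | gamma j < 0]%SET| = 2%N)
    (hpos : #|[set j : 'I_d.+2 | 0 < gamma j]%SET| = 3%N) :
  exists n : nat,
    (closure_points (newton_polytope R m) (laurent_of m u) #= `I_n)%card /\
    (n%:R : R[i]) =
      #|F|%:R ^+ 2 + 3 * #|F|%:R + 1
      - \sum_(lam in Lambda #|F|.-1 H^T)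
          (character_pow chi lam (sigma_param rho u))^-1
          * #|F|%:R ^ ((s_mult R #|F|.-1 gamma (delta_of rho lam) 0)%:Z - 1)
          * gauss_prod psi chi (delta_of rho lam)
          * hypergeometric_sum psi chi gamma (delta_of rho lam)
              (t_param gamma u / gamma_gamma F gamma).
Proof.
have d3 : d = 3%N.
  have := cardsC [set j : 'I_d.+2 | gamma j < 0]%SET.
  by rewrite setC_neg // hneg hpos card_ord => -[].
subst d.
have G := gale_splittingP hgale hgamma hf hc hH hHNF hrho.
have [n [cn qn]] := closure_card G hpsi hchi hord hu hm isT.
exists n; split=> //.
have q0 : #|F|%:R != 0 :> R[i] by rewrite pnatr_eq0 card_F.
have Q0 : #|F|.-1%:R != 0 :> R[i] by exact: Q_neq0.
apply: (mulfI q0); rewrite qn (face_sum _ hgamma _ hpsi) //.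
rewrite (sum_relations hgale hf hc hA hH hrho).
have gg0 : gamma_gamma F gamma != 0.
  apply/prodf_neq0 => j _; apply/expfz_neq0/intr_neq0_coprime.
  by apply: coprime_dvdr hcop; rewrite (bigD1 j) //= abszM dvdn_mulr.
have T0 : t_param gamma u != 0 by apply/prodf_neq0 => j _; rewrite expfz_neq0.
rewrite mulrBr mulr_sumr mulr_sumr.
have -> : #|F|%:R ^+ 3 + 3 * #|F|%:R ^+ 2 + #|F|%:R =
  #|F|%:R * (#|F|%:R ^+ 2 + 3 * #|F|%:R + 1) :> R[i] by ring.
rewrite -sumrN; congr (_ + _); apply: eq_bigr => lam _.
set delta := delta_of rho lam.
have gd0 : gauss_prod psi chi delta != 0.
  by apply/prodf_neq0 => j _; exact: gauss_sum_neq0.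
have Q1 : 1 - #|F|%:R = - #|F|.-1%:R :> R[i].
  by rewrite [in LHS]card_F -natr1 opprD addrC subrK.
rewrite /hypergeometric_sum (mulrC (gamma_gamma F gamma)) divfK // big_mkord.
rewrite (normalized_sum _ _ _ _ _ q0 Q0 gd0 Q1) opprK; congr (_ * _).
apply: eq_bigr => t _.
by rewrite (gauss_term_relation_of gamma psi hchi hord hu) (zero_mult_relation_of gamma R).
Qed.
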